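(* Let $n\ge4$, let $A$ be a diagonal positive definite $n\times n$ matrix with simple eigenvalues, let $\mathcal{E}_A=\{x\in\mathbb{R}^n:\langle A^{-1}x,x\rangle=1\}$ with the induced metric $g$, and let $x_0\in\mathcal{E}_A$ be a self-focal point. Then $S^*_{x_0}\mathcal{E}_A$ lies on a single level set of the eigenvalue moment map $\mathcal{P}_e=(e_1,\dots,e_{n-2}):S^*\mathcal{E}_A\to\mathbb{R}^{n-2}$, and $S^*_{x_0}\mathcal{E}_A$ is a leaf of the reduced foliation of $S^*_H\mathcal{E}_A$. Moreover, $\Lambda_{x_0}=\bigcup_{t\in\mathbb{R}}G^t(S^*_{x_0}\mathcal{E}_A)$ is the closure of a regular orbit.
   Context: A point $x_0$ is self-focal if there is $T>0$ with $\exp_{x_0}(T\xi)=x_0$ for all $\xi\in S^*_{x_0}\mathcal{E}_A$. $G^t$ is the geodesic flow on $S^*\mathcal{E}_A$; covectors are identified with tangent vectors in $\mathbb{R}^n$. For $(x,\xi)\in T^*\mathcal{E}_A\setminus0$ let $L(x,\xi)=P_\xi(A-x\otimes x^* )P_\xi$, with $P_\xi$ the orthogonal projection onto $\xi^\perp$. It has $0$ as eigenvalue of multiplicity two; the other eigenvalues are $\lambda_1\le\dots\le\lambda_{n-2}$, and $e_j$ is the $j$-th elementary symmetric function of $\lambda_1,\dots,\lambda_{n-2}$. The functions $|\xi|_g^2,e_1,\dots,e_{n-2}$ Poisson commute and their Hamiltonian flows generate an $\mathbb{R}^{n-1}$-action; ''orbit'' refers to this action, and an orbit is regular if the differentials of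 these $n-1$ functions are linearly independent along it. $H\subset\mathcal{E}_A$ is an (open piece of a) hypersurface of $\mathcal{E}_A$ through $x_0$ with non-degenerate second fundamental form, and $S^*_H\mathcal{E}_A$ is the set of unit covectors to $\mathcal{E}_A$ with footpoint on $H$. The reduced foliation is the (singular) foliation of $S^*_H\mathcal{E}_A$ obtained by intersecting the (singular) foliation of $S^*\mathcal{E}_A$ by $\mathbb{R}^{n-1}$-orbits with $S^*_H\mathcal{E}_A$. *)

(* Defs.v *)
From HB Require Import structures.
From mathcomp Require Import all_boot all_order all_algebra.
From mathcomp Require Import all_classical all_reals all_analysis.
Set Implicit Arguments.
Unset Strict Implicit.
Unset Printing Implicit Defensive.
Import Order.TTheory GRing.Theory Num.Theory.
Import numFieldNormedType.Exports.
Local Open Scope classical_set_scope.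
Local Open Scope ring_scope.

Section LinearAlgebra.
Context {R : realType} {n : nat}.
Implicit Types (A : 'M[R]_n) (u v x xi : 'cV[R]_n).

Definition dot u v : R := \sum_i u i 0 * v i 0.

Definition positive_definite A : Prop :=
  A^T = A /\ forall v, v != 0 -> 0 < dot (A *m v) v.

Definition simple_eigenvalues A : Prop :=
  forall a, eigenvalue A a -> mup a (char_poly A) = 1%N.

Definition orth_proj xi : 'M[R]_n := 1%:M - (dot xi xi)^-1 *: (xi *m xi^T).

End LinearAlgebra.

(* A point (x, xi) of 'cV[R]_n * 'cV[R]_n stands for a covector of the
   ellipsoid at x, identified with a tangent vector by the induced metric. *)
Section Ellipsoid.
Context {R : realType} {n : nat}.
Variable A : 'M[R]_n.
Local Notation vec := 'cV[R]_n.
Local Notation phase := ('cV[R]_n * 'cV[R]_n)%type.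

Definition conormal (x : vec) : vec := invmx A *m x.

Definition ellipsoid : set vec := [set x | dot (conormal x) x = 1].

Definition tangent (x : vec) : set vec := [set v | dot (conormal x) v = 0].

Definition cotangent0 : set phase :=
  [set p | ellipsoid p.1 /\ tangent p.1 p.2 /\ p.2 != 0].

Definition cosphere : set phase :=
  [set p | ellipsoid p.1 /\ tangent p.1 p.2 /\ dot p.2 p.2 = 1].

Definition cosphere_at (x : vec) : set phase := [set p | cosphere p /\ p.1 = x].

Definition cosphere_over (H : set vec) : set phase :=
  [set p | cosphere p /\ H p.1].

(* A curve of the ellipsoid is a geodesic for the induced metric when its
   acceleration is normal to the ellipsoid. *)
Definition geodesic (c : R -> vec) : Prop :=
  forall t, [/\ ellipsoid (c t), derivable c t 1, derivable (derive1 c) t 1 &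
    forall v, tangent (c t) v -> dot (derive1 (derive1 c) t) v = 0].

(* The graph of the exponential map: exp_x v = y. *)
Definition exp_graph (x v y : vec) : Prop :=
  exists c, [/\ geodesic c, c 0 = x, derive1 c 0 = v & c 1 = y].

Definition self_focal (x : vec) : Prop :=
  exists2 T : R, 0 < T &
    forall p, cosphere_at x p -> exp_graph x (T *: p.2) x.

(* The graph of the time-t geodesic flow: G^t p = q. *)
Definition geodesic_flow (t : R) (p q : phase) : Prop :=
  exists c, [/\ geodesic c, (c 0, derive1 c 0) = p & (c t, derive1 c t) = q].

Definition flow_out (x : vec) : set phase :=
  \bigcup_(t in [set: R])
    [set q | exists2 p, cosphere_at x p & geodesic_flow t p q].

Definition Lmx (p : phase) : 'M[R]_n :=
  orth_proj p.2 *m (A - p.1 *m p.1^T) *m orth_proj p.2.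

Definition is_spectrum (p : phase) (l : (n - 2).-tuple R) : Prop :=
  sorted <=%R l /\
  char_poly (Lmx p) = 'X^2 * \prod_(a <- l) ('X - a%:P).

(* On cotangent0, Lmx p is symmetric with kernel spanned by the independent
   vectors p.2 and conormal p.1, so a (unique) l with is_spectrum p l exists:
   the default value is only used away from cotangent0. *)
Definition spectrum (p : phase) : (n - 2).-tuple R :=
  xget [tuple of nseq (n - 2) 0] [set l | is_spectrum p l].

Definition elem_sym (j : nat) (p : phase) : R :=
  \sum_(I : {set 'I_(n - 2)} | #|I| == j) \prod_(i in I) tnth (spectrum p) i.

Definition moment_map (p : phase) : 'rV[R]_(n - 2) :=
  \row_(j < n - 2) elem_sym j.+1 p.

(* Index 0 is |xi|_g^2 and index j > 0 is e_j. *)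
Definition integral_of_motion (k : 'I_(n - 1)) (p : phase) : R :=
  if k == 0%N :> nat then dot p.2 p.2 else elem_sym k p.

(* The differential at p of f, a function on cotangent0, is l; only the values
   of l on tangent vectors to cotangent0 at p matter. *)
Definition is_differential (f : phase -> R) (p : phase) (l : phase -> R) :=
  forall (c : R -> phase) (w : phase),
    (forall t, cotangent0 (c t)) -> c 0 = p -> is_derive (0 : R) (1 : R) c w ->
    is_derive (0 : R) (1 : R) (f \o c) (l w).

(* The canonical form of the cotangent bundle, read through the metric, is the
   restriction of \sum_i dx_i /\ dxi_i. *)
Definition symplectic (v w : phase) : R := dot v.1 w.2 - dot v.2 w.1.

Definition hamiltonian_curve (f : phase -> R) (c : R -> phase) : Prop :=
  forall t, [/\ cotangent0 (c t), derivable c t 1 &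
    is_differential f (c t) (symplectic (derive1 c t))].

Definition hamiltonian_flow (f : phase -> R) (t : R) (p q : phase) : Prop :=
  exists c, [/\ hamiltonian_curve f c, c 0 = p & c t = q].

(* q is the image of p under the element s of the R^(n-1)-action, that is under
   the composition of the time-(s k) flows of the n - 1 integrals. *)
Definition action_graph (s : 'I_(n - 1) -> R) (p q : phase) : Prop :=
  exists z : nat -> phase, [/\ z 0%N = p, z (n - 1)%N = q &
    forall k : 'I_(n - 1),
      hamiltonian_flow (integral_of_motion k) (s k) (z k) (z k.+1)].

Definition orbit_of (p : phase) : set phase :=
  [set q | exists s, action_graph s p q].

Definition independent_at (p : phase) : Prop :=
  forall a : 'I_(n - 1) -> R,
    is_differential (fun q => \sum_k a k * integral_of_motion k q) p
      (fun _ => 0) ->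
    forall k, a k = 0.

Definition regular_orbit (O : set phase) : Prop :=
  (exists2 p, cosphere p & O = orbit_of p) /\ forall q, O q -> independent_at q.

Fixpoint C_on (k : nat) (U : set vec) (h : vec -> R) : Prop :=
  match k with
  | 0%N => forall x, U x -> {for x, continuous h}
  | k'.+1 => (forall x, U x -> differentiable h x) /\
             forall v, C_on k' U (fun x => 'D_v h x)
  end.

Definition smooth_on (U : set vec) (h : vec -> R) : Prop :=
  forall k, C_on k U h.

Definition gradient (h : vec -> R) (x : vec) : vec :=
  \col_i 'D_(delta_mx i 0) h x.

Definition ellipsoid_gradient (h : vec -> R) (x : vec) : vec :=
  orth_proj (conormal x) *m gradient h x.

Definition local_equation (H U : set vec) (h : vec -> R) : Prop :=
  [/\ open U, smooth_on U h,
      forall x, U x -> ellipsoid x -> (H x <-> h x = 0) &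
      forall x, U x -> H x -> ellipsoid_gradient h x != 0].

(* Embedded, not necessarily closed, hypersurfaces of the ellipsoid. *)
Definition hypersurface (H : set vec) : Prop :=
  H `<=` ellipsoid /\
  forall x, H x -> exists U h, U x /\ local_equation H U h.

Definition tangent_hypersurface (h : vec -> R) (x : vec) : set vec :=
  [set v | tangent x v /\ dot (gradient h x) v = 0].

Definition unit_normal (h : vec -> R) (x : vec) : vec :=
  let g := ellipsoid_gradient h x in (Num.sqrt (dot g g))^-1 *: g.

(* Weingarten's formula: the Levi-Civita derivative of the normal and its
   derivative in 'cV[R]_n have the same inner product with w. *)
Definition second_fundamental_form (h : vec -> R) (x v w : vec) : R :=
  - dot ('D_v (unit_normal h) x) w.

Definition nondegenerate_second_fundamental_form (H : set vec) : Prop :=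
  forall x U h, H x -> U x -> local_equation H U h ->
  forall v, tangent_hypersurface h x v ->
    (forall w, tangent_hypersurface h x w ->
       second_fundamental_form h x v w = 0) ->
    v = 0.

(* Leaves being connected, those of the intersected foliation are the components
   of the sets O `&` cosphere_over H, with O an orbit.  Path components are
   used since O may be dense in a torus: continuous paths in O stay in a single
   plaque locally. *)
Definition path_component (X : set phase) (p : phase) : set phase :=
  [set q | exists c : R -> phase,
     [/\ {within `[0, 1], continuous c}, c 0 = p, c 1 = q &
         forall t, 0 <= t <= 1 -> X (c t)]].

Definition reduced_leaf (H : set vec) (Y : set phase) : Prop :=
  exists2 p, cosphere_over H p &
    Y = path_component (orbit_of p `&` cosphere_over H) p.

End Ellipsoid.

(* Main.v *)
(* For n >= 4 an ellipsoid with distinct axes has no self-focal point, so the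
   hypotheses of the theorem are contradictory.

   Along a geodesic all coordinates solve x_i'' = - (g / a_i) x_i with the same
   function g, and for each k the quadratic form in the velocity
     F_k = v_k^2 + \sum_(j != k) (x_k v_j - x_j v_k)^2 / (a_k - a_j)
   is conserved.  If a_k is not extreme and x0_k != 0, then F_k is indefinite on
   the tangent space at x0.  Along a geodesic with F_k = 0 the quantity
     S = \sum_(j != k) x_j v_j / (a_k - a_j)
         - (1 + \sum_(j != k) x_j^2 / (a_k - a_j)) v_k / x_k
   satisfies S' = g x_k^2 / a_k^2, hence increases by a definite amount at each
   return to x0, although it is bounded over x0.  So x0 lies on the ellipse E in
   the plane of the two extreme axes.

   There are at least two other axes, and x0 is an umbilic of the 2-dimensional
   ellipsoid spanned by E and the k-th axis for at most one k; choose another k.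
   A geodesic leaving x0 almost tangentially to E, with small k-th velocity e,
   returns with k-th velocity e or - e because F_k is conserved.  But E is
   hyperbolic in the direction of the k-th axis: if l is the linear form
   vanishing at one pair of opposite umbilics and y = x_k, then
   Z = l y' - l' y + r l y satisfies Z' = r Z + O(e^2) for an explicit r bounded
   below by a positive constant, whereas Z^2 takes the same value
   l(x0)^2 e^2 at both ends. *)

Require Import Defs.
From HB Require Import structures.
From mathcomp Require Import all_boot all_order all_algebra.
From mathcomp Require Import all_classical all_reals all_analysis.
From mathcomp Require Import zify ring lra.
Import Order.TTheory GRing.Theory Num.Theory.
Import numFieldNormedType.Exports.
Local Open Scope classical_set_scope.
Local Open Scope ring_scope.

Set Implicit Arguments.
Unset Strict Implicit.
Unset Printing Implicit Defensive.

(** * One-variable calculus *)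

Section Calculus.
Context {R : realType}.
Implicit Types (f g df : R -> R) (t a b k : R).

Lemma is_derive1_eq f t a b :
  is_derive t 1 f a -> a = b -> is_derive t 1 f b.
Proof. by move=> h <-. Qed.

Lemma is_derive1_cst k t : is_derive t 1 (fun=> k) 0.
Proof. exact: is_derive_cst. Qed.

Lemma is_derive1_id t : is_derive t 1 (fun s => s) 1.
Proof. exact: is_derive_id. Qed.

Lemma is_derive1D f g t a b : is_derive t 1 f a -> is_derive t 1 g b ->
  is_derive t 1 (fun s => f s + g s) (a + b).
Proof. by move=> df dg; exact: is_deriveD. Qed.

Lemma is_derive1N f t a : is_derive t 1 f a ->
  is_derive t 1 (fun s => - f s) (- a).
Proof. by move=> df; exact: is_deriveN. Qed.

Lemma is_derive1M f g t a b : is_derive t 1 f a -> is_derive t 1 g b ->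
  is_derive t 1 (fun s => f s * g s) (f t * b + g t * a).
Proof. by move=> df dg; exact: is_deriveM. Qed.

Lemma is_derive1_sqr f t a : is_derive t 1 f a ->
  is_derive t 1 (fun s => f s ^+ 2) (2 * f t * a).
Proof.
move=> df; rewrite [X in is_derive _ _ X](_ : _ = fun s => f s * f s).
  by refine (is_derive1_eq (is_derive1M df df) _); ring.
by apply/funext => s; rewrite expr2.
Qed.

Lemma is_derive1V f t a : f t != 0 -> is_derive t 1 f a ->
  is_derive t 1 (fun s => (f s)^-1) (- (f t ^- 2) * a).
Proof. by move=> ft df; exact: is_deriveV. Qed.

Lemma is_derive1_sqrtf f t a : 0 < f t -> is_derive t 1 f a ->
  is_derive t 1 (fun s => Num.sqrt (f s)) ((2 * Num.sqrt (f t))^-1 * a).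
Proof.
by move=> ft df; apply: (@is_derive1_comp _ Num.sqrt f); exact: is_derive1_sqrt.
Qed.

Lemma is_derive1_expRM k t :
  is_derive t 1 (fun s => expR (k * s)) (expR (k * t) * k).
Proof.
have dk := is_derive1M (is_derive1_cst k t) (is_derive1_id t).
refine (is_derive1_eq (@is_derive1_comp _ expR (fun s => k * s) _ _ _ _ dk) _).
by rewrite /=; ring.
Qed.

Lemma is_derive1_sum (I : finType) (P : pred I) (F : I -> R -> R)
    (D : I -> R) t : (forall i, is_derive t 1 (F i) (D i)) ->
  is_derive t 1 (fun s => \sum_(i | P i) F i s) (\sum_(i | P i) D i).
Proof.
move=> dF; elim: (index_enum I) => [|i r IH].
  rewrite big_nil [X in is_derive _ _ X](_ : _ = fun=> 0).
    exact: is_derive1_cst.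
  by apply/funext => s; rewrite big_nil.
rewrite big_cons; case: ifPn => Pi.
  rewrite [X in is_derive _ _ X](_ : _ =
    fun s => F i s + \sum_(i <- r | P i) F i s).
    exact: is_derive1D.
  by apply/funext => s; rewrite big_cons Pi.
rewrite [X in is_derive _ _ X](_ : _ = fun s => \sum_(i <- r | P i) F i s) //.
by apply/funext => s; rewrite big_cons (negbTE Pi).
Qed.

Lemma is_derive1_continuous f df : (forall t, is_derive t 1 f (df t)) ->
  continuous f.
Proof.
move=> dfE t; apply/differentiable_continuous/derivable1_diffP.
by have [] := dfE t.
Qed.

Lemma le_of_ge0_derive f df a b : (forall t, is_derive t 1 f (df t)) ->
  a <= b -> (forall t, a <= t <= b -> 0 <= df t) -> f a <= f b.
Proof.
move=> dfE ab df0.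
have cf := continuous_subspaceT (is_derive1_continuous dfE) (A := `[a, b]).
have [c cab E] := MVT_segment ab (fun x _ => dfE x) cf.
by rewrite -subr_ge0 E mulr_ge0 ?subr_ge0// df0.
Qed.

Lemma eq_of_derive0 f a b : (forall t, is_derive t 1 f 0) -> f a = f b.
Proof. by move=> df; apply: is_derive_0_is_cst. Qed.

(** The product [f * exp (- k t)] is nondecreasing. The sign of [k] is free; a negative [k] limits
    how fast an energy can decay. *)
Lemma gronwall_ge f df k a b : (forall t, is_derive t 1 f (df t)) ->
  a <= b -> (forall t, a <= t <= b -> k * f t <= df t) ->
  f a * expR (k * (b - a)) <= f b.
Proof.
move=> dfE ab dfk.
have dg t : is_derive t 1 (fun s => f s * expR (- k * s))
    (expR (- k * t) * (df t - k * f t)).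
  by refine (is_derive1_eq (is_derive1M (dfE t) (is_derive1_expRM _ t)) _); ring.
have := le_of_ge0_derive dg ab.
have -> : f a * expR (k * (b - a)) =
    f a * expR (- k * a) * expR (k * b).
  by rewrite -mulrA -expRD; congr (_ * expR _); ring.
have {2}-> : f b = f b * expR (- k * b) * expR (k * b).
  by rewrite -mulrA -expRD mulNr addNr expR0 mulr1.
move=> h; rewrite ler_pM2r ?expR_gt0//; apply: h => t tab.
by rewrite mulr_ge0 ?expR_ge0// subr_ge0 dfk.
Qed.

Lemma gronwall_le f df k a b : (forall t, is_derive t 1 f (df t)) ->
  a <= b -> (forall t, a <= t <= b -> df t <= k * f t) ->
  f b <= f a * expR (k * (b - a)).
Proof.
move=> dfE ab dfk; rewrite -lerN2 -mulNr.
apply: (@gronwall_ge (fun t => - f t) (fun t => - df t)) => // t tab.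
by rewrite mulrN lerN2 dfk.
Qed.

Lemma continuous_gt0 f a b : continuous f -> a <= b -> 0 < f a ->
  (forall t, a <= t <= b -> f t != 0) -> forall t, a <= t <= b -> 0 < f t.
Proof.
move=> cf ab fa fn0 t /andP[at_ tb]; rewrite ltNge; apply/negP => ft.
have ft0 : Num.min (f a) (f t) <= 0 <= Num.max (f a) (f t).
  by rewrite ge_min le_max (ltW fa) ft orbT.
have [c cat fc] := IVT at_ (continuous_subspaceT cf) ft0.
have := fn0 c; rewrite fc eqxx; move: cat; rewrite in_itv /= => /andP[-> ct].
by rewrite (le_trans ct tb) => /(_ isT).
Qed.

End Calculus.

(** The derivative is an existential variable, filled in along the shape of the function, with the
    hypotheses in context differentiating the atoms; [derive_rules] then leaves its equality with
    the expected value. *)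
Ltac derive_step :=
  lazymatch goal with
  | |- is_derive ?t _ (fun s => @?f s + @?g s) _ => eapply (@is_derive1D _ f g)
  | |- is_derive ?t _ (fun s => - @?f s) _ => eapply (@is_derive1N _ f)
  | |- is_derive ?t _ (fun s => @?f s ^+ 2) _ => eapply (@is_derive1_sqr _ f)
  | |- is_derive ?t _ (fun s => @?f s * @?g s) _ => eapply (@is_derive1M _ f g)
  | |- is_derive _ _ _ _ =>
      match goal with
      | |- _ => solve [eapply is_derive1_cst]
      | H : _ |- _ => solve [eapply (H _)]
      | H : _ |- _ => solve [eapply H]
      end
  end.
Ltac derive_rules := eapply is_derive1_eq; [repeat derive_step|].

(** * Geodesics in coordinates *)

Section StringFlow.
Context {R : realType} {I : finType}.
Variable a : I -> R.
Hypothesis a_gt0 : forall i, 0 < a i.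

Definition qform (X Y : I -> R) : R := \sum_i X i * Y i / a i.
Definition nform (X : I -> R) : R := \sum_i X i ^+ 2 / a i ^+ 2.

(** The equation [x'' = - g A^-1 x] for [A = diag(a)], with Lagrange multiplier [g]. The last clause
    amounts to the second derivative of the constraint and determines [g]. *)
Definition string_flow (x v : I -> R -> R) (g : R -> R) : Prop :=
  [/\ forall i (t : R), is_derive t 1 (x i) (v i t),
      forall i (t : R), is_derive t 1 (v i) (- (g t / a i) * x i t),
      forall t, qform (x ^~ t) (x ^~ t) = 1 &
      forall t, g t * nform (x ^~ t) = qform (v ^~ t) (v ^~ t)].

(* The resolvent form of diag(a) at a k, with the pole removed. *)
Definition rform (k : I) (X Y : I -> R) : R :=
  \sum_(j | j != k) X j * Y j / (a k - a j).

Definition pform (k : I) (X Y : I -> R) : R :=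
  rform k X Y * X k - (1 + rform k X X) * Y k.
Definition qpform (k : I) (X Y : I -> R) : R :=
  rform k Y Y * X k - rform k X Y * Y k.

(* This is the integral F_k; the choice of pform and qpform comes from
   flow_pform and flow_qpform, by which (pform, qpform) nearly solves the same
   linear equation as (X k, Y k). *)
Definition integral_at (k : I) (X Y : I -> R) : R :=
  X k * qpform k X Y - Y k * pform k X Y.

Lemma a_neq0 i : a i != 0. Proof. by rewrite gt_eqF. Qed.

Lemma nform_gt0 X : qform X X = 1 -> 0 < nform X.
Proof.
move=> X1; rewrite lt_neqAle sumr_ge0 ?andbT; last first.
  by move=> i _; rewrite divr_ge0 ?sqr_ge0.
apply/eqP => /esym /eqP; rewrite psumr_eq0 => [/allP X0|i _]; last first.
  by rewrite divr_ge0 ?sqr_ge0.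
suff X0' : qform X X = 0 by move: X1; rewrite X0' => /eqP; rewrite eq_sym oner_eq0.
apply: big1 => i _; have := X0 i (mem_index_enum i).
rewrite mulf_eq0 invr_eq0 sqrf_eq0 sqrf_eq0 (negbTE (a_neq0 i)) orbF => /eqP ->.
by rewrite !mul0r.
Qed.

Lemma unit_tangent (x v : I -> R -> R) (t : R) :
  (forall i (t : R), is_derive t 1 (x i) (v i t)) ->
  (forall t, qform (x ^~ t) (x ^~ t) = 1) -> qform (x ^~ t) (v ^~ t) = 0.
Proof.
move=> dx x1; have d : is_derive t 1 (fun s => qform (x ^~ s) (x ^~ s))
    (\sum_i 2 * (x i t * v i t / a i)).
  by apply: is_derive1_sum => i; derive_rules; ring.
rewrite [X in is_derive _ _ X](_ : _ = fun=> 1) in d; last exact/funext.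
have := @derive_val _ _ _ _ _ _ _ d; rewrite derive_cst -mulr_sumr => /esym.
by move/eqP; rewrite mulf_eq0 pnatr_eq0 /= => /eqP.
Qed.

(** The vector [u = w + g A^-1 x] is tangent by the choice of [g]. Both [w] and [A^-1 x] are
    orthogonal to tangent vectors, so [u] is orthogonal to itself. *)
Lemma normal_acceleration_flow (x v w : I -> R -> R) :
  (forall i (t : R), is_derive t 1 (x i) (v i t)) ->
  (forall i (t : R), is_derive t 1 (v i) (w i t)) ->
  (forall t, qform (x ^~ t) (x ^~ t) = 1) ->
  (forall t u, qform (x ^~ t) u = 0 -> \sum_i w i t * u i = 0) ->
  string_flow x v (fun t => qform (v ^~ t) (v ^~ t) / nform (x ^~ t)).
Proof.
move=> dx dv x1 wn; have N0 t : nform (x ^~ t) != 0 by rewrite gt_eqF// nform_gt0.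
split=> // [i t|t]; last by rewrite divfK.
set g := qform _ _ / _; pose u i := w i t + g * x i t / a i.
have xw : qform (x ^~ t) (w ^~ t) + qform (v ^~ t) (v ^~ t) = 0.
  have d : is_derive t 1 (fun s => qform (x ^~ s) (v ^~ s))
      (\sum_i (x i t * w i t / a i + v i t * v i t / a i)).
    by apply: is_derive1_sum => m; derive_rules; ring.
  rewrite [X in is_derive _ _ X](_ : _ = fun=> 0) in d; last first.
    by apply/funext => s; exact: unit_tangent.
  have := @derive_val _ _ _ _ _ _ _ d; rewrite derive_cst big_split /= => /esym.
  exact.
have xu : qform (x ^~ t) u = 0.
  transitivity (qform (x ^~ t) (w ^~ t) + g * nform (x ^~ t)).
    rewrite /qform /nform mulr_sumr -big_split /=; apply: eq_bigr => m _.
    by rewrite /u; field; exact: a_neq0.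
  by rewrite /g divfK.
have uu : \sum_m u m ^+ 2 = 0.
  transitivity (\sum_m w m t * u m + g * qform (x ^~ t) u).
    rewrite /qform mulr_sumr -big_split /=; apply: eq_bigr => m _.
    by rewrite /u; field; exact: a_neq0.
  by rewrite (wn t u xu) xu mulr0 addr0.
have /eqP := uu; rewrite psumr_eq0 => [/allP u0|m _]; last exact: sqr_ge0.
have := u0 i (mem_index_enum i); rewrite sqrf_eq0 /u addr_eq0 => /eqP wi.
by have := dv i t; rewrite wi => h; refine (is_derive1_eq h _); ring.
Qed.

Section Flow.
Variables (x v : I -> R -> R) (g : R -> R).
Hypothesis xvg : string_flow x v g.

Let dx i (t : R) : is_derive t 1 (x i) (v i t). Proof. by case: xvg. Qed.
Let dv i (t : R) : is_derive t 1 (v i) (- (g t / a i) * x i t).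
Proof. by case: xvg. Qed.

Lemma flow_tangent t : qform (x ^~ t) (v ^~ t) = 0.
Proof. by case: xvg => _ _ x1 _; exact: unit_tangent. Qed.

Lemma flow_speed t : \sum_i v i t ^+ 2 = \sum_i v i 0 ^+ 2.
Proof.
apply: (@eq_of_derive0 _ (fun t => \sum_i v i t ^+ 2)) => s.
have d : is_derive s 1 (fun s => \sum_i v i s ^+ 2)
    (\sum_i (- 2 * g s) * (x i s * v i s / a i)).
  by apply: is_derive1_sum => i; derive_rules; ring.
by apply: is_derive1_eq d _; rewrite -mulr_sumr [\sum_i _]flow_tangent mulr0.
Qed.

(** Joachimsthal's integral. With [M = <A^-2 x, v>] the two factors have derivatives [- 2 g M] and
    [2 M], and [g * nform = qform] makes the contributions cancel. *)
Lemma flow_joachimsthal t : qform (v ^~ t) (v ^~ t) * nform (x ^~ t) =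
  qform (v ^~ 0) (v ^~ 0) * nform (x ^~ 0).
Proof.
apply: (@eq_of_derive0 _
  (fun t => qform (v ^~ t) (v ^~ t) * nform (x ^~ t))) => s.
pose M := \sum_i x i s * v i s / a i ^+ 2.
have dq : is_derive s 1 (fun s => qform (v ^~ s) (v ^~ s)) (- 2 * g s * M).
  rewrite mulr_sumr; apply: is_derive1_sum => i; derive_rules.
  by rewrite expr2 invfM; ring.
have dn : is_derive s 1 (fun s => nform (x ^~ s)) (2 * M).
  by rewrite mulr_sumr; apply: is_derive1_sum => i; derive_rules; ring.
derive_rules; have [_ _ _ <-] := xvg; ring.
Qed.

Lemma flow_rform_xx k (t : R) :
  is_derive t 1 (fun s => rform k (x ^~ s) (x ^~ s))
    (2 * rform k (x ^~ t) (v ^~ t)).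
Proof.
by rewrite mulr_sumr; apply: is_derive1_sum => i; derive_rules; ring.
Qed.

Hypothesis a_inj : injective a.

(** Partial fractions: [1 / (a_j (a_k - a_j)) = (1 / a_j + 1 / (a_k - a_j)) / a_k]. The divisor
    [a_j] comes from the acceleration, and [qform] has known values on [(x, x)] and [(x, v)]. *)
Lemma rform_div k X Y : \sum_(j | j != k) X j * Y j / (a j * (a k - a j)) =
  (qform X Y + rform k X Y - X k * Y k / a k) / a k.
Proof.
have -> : qform X Y + rform k X Y - X k * Y k / a k =
    \sum_(j | j != k) X j * Y j / a j + rform k X Y.
  by rewrite /qform (bigD1 k) //=; ring.
rewrite /rform -big_split /= mulr_suml; apply: eq_bigr => j jk.
have akj : a k - a j != 0 by rewrite subr_eq0 (inj_eq a_inj) eq_sym.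
by field; rewrite akj !a_neq0.
Qed.

Lemma flow_rform_xv k (t : R) :
  is_derive t 1 (fun s => rform k (x ^~ s) (v ^~ s))
    (rform k (v ^~ t) (v ^~ t) -
     g t / a k * (1 + rform k (x ^~ t) (x ^~ t) - x k t ^+ 2 / a k)).
Proof.
have [_ _ x1 _] := xvg.
have d : is_derive t 1 (fun s => rform k (x ^~ s) (v ^~ s))
    (\sum_(j | j != k) (v j t * v j t / (a k - a j) -
       g t * (x j t * x j t / (a j * (a k - a j))))).
  apply: is_derive1_sum => i; derive_rules.
  by rewrite invfM; ring.
apply: is_derive1_eq d _; rewrite sumrB -mulr_sumr rform_div x1.
by rewrite /rform expr2; field; exact: a_neq0.
Qed.

Lemma flow_rform_vv k (t : R) :
  is_derive t 1 (fun s => rform k (v ^~ s) (v ^~ s))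
    (- 2 * g t / a k * (rform k (x ^~ t) (v ^~ t) - x k t * v k t / a k)).
Proof.
have d : is_derive t 1 (fun s => rform k (v ^~ s) (v ^~ s))
    (\sum_(j | j != k) (- 2 * g t) * (x j t * v j t / (a j * (a k - a j)))).
  apply: is_derive1_sum => i; derive_rules.
  by rewrite invfM; ring.
apply: is_derive1_eq d _; rewrite -mulr_sumr rform_div flow_tangent.
by field; exact: a_neq0.
Qed.

(** The pair [(x_k, v_k)] solves the same linear system without remainder. The remainders here and
    in [flow_qpform] form the vector [g x_k^2 / a_k^2] times [(x_k, v_k)]. *)
Lemma flow_pform k (t : R) :
  is_derive t 1 (fun s => pform k (x ^~ s) (v ^~ s))
    (qpform k (x ^~ t) (v ^~ t) + g t / a k ^+ 2 * x k t ^+ 3).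
Proof.
have d1 := flow_rform_xx k; have d2 := flow_rform_xv k.
by rewrite /pform; derive_rules; rewrite /qpform; field; exact: a_neq0.
Qed.

Lemma flow_qpform k (t : R) :
  is_derive t 1 (fun s => qpform k (x ^~ s) (v ^~ s))
    (- (g t / a k) * pform k (x ^~ t) (v ^~ t) +
     g t / a k ^+ 2 * x k t ^+ 2 * v k t).
Proof.
have d1 := flow_rform_vv k; have d2 := flow_rform_xv k.
by rewrite /qpform; derive_rules; rewrite /pform; field; exact: a_neq0.
Qed.

(** The integral is the Wronskian of [(x_k, v_k)] and [(pform, qpform)], to which a remainder
    proportional to [(x_k, v_k)] contributes nothing. *)
Lemma flow_integral_at k (t : R) :
  integral_at k (x ^~ t) (v ^~ t) = integral_at k (x ^~ 0) (v ^~ 0).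
Proof.
apply: (@eq_of_derive0 _
  (fun t => integral_at k (x ^~ t) (v ^~ t))) => s.
have d1 := flow_pform k; have d2 := flow_qpform k.
by rewrite /integral_at; derive_rules; field; exact: a_neq0.
Qed.

End Flow.
End StringFlow.

(** * Isotropic tangent vectors for a middle axis *)

Section IsotropicDirection.
Context {R : realType} {I : finType}.
Variable a : I -> R.
Hypothesis a_gt0 : forall i, 0 < a i.
Hypothesis a_inj : injective a.

Lemma quadratic_root (p q r : R) : 0 < p -> r < 0 ->
  exists t, p + 2 * q * t + r * t ^+ 2 = 0.
Proof.
move=> p0 r0; have D0 : 0 <= q ^+ 2 - p * r.
  by rewrite subr_ge0 (le_trans _ (sqr_ge0 q))// pmulr_rle0// ltW.
exists ((- q + Num.sqrt (q ^+ 2 - p * r)) / r).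
have := sqr_sqrtr D0; set s := Num.sqrt _ => sE.
have -> : p + 2 * q * ((- q + s) / r) + r * ((- q + s) / r) ^+ 2 =
  (s ^+ 2 - (q ^+ 2 - p * r)) / r by field; rewrite lt_eqF.
by rewrite sE subrr mul0r.
Qed.

Lemma rform_scale (X Y : I -> R) k c :
  rform a k X (fun i => c * Y i) = c * rform a k X Y.
Proof. by rewrite /rform mulr_sumr; apply: eq_bigr => i _; ring. Qed.

Lemma rformC (X Y : I -> R) k : rform a k X Y = rform a k Y X.
Proof. by apply: eq_bigr => i _; rewrite [X i * _]mulrC. Qed.

Lemma rformB (X Y Z : I -> R) k c : rform a k X (fun i => Y i - c * Z i) =
  rform a k X Y - c * rform a k X Z.
Proof. by rewrite /rform mulr_sumr -sumrB; apply: eq_bigr => i _; ring. Qed.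

(* The projection to the tangent space at X of a vector with vanishing k-th
   coordinate diagonalises the k-th integral up to a rank one term. *)
Lemma integral_at_proj (X y : I -> R) k : qform a X X = 1 -> y k = 0 ->
  let N := nform a X in let Q := qform a X y in
  integral_at a k X (fun i => y i - Q / N * (X i / a i)) =
  X k ^+ 2 * (rform a k y y - Q ^+ 2 / (a k * N)).
Proof.
move=> X1 yk N Q; pose nu i := X i / a i.
have N0 : N != 0 by rewrite gt_eqF// nform_gt0.
have a0 := a_neq0 a_gt0.
have rXnu : rform a k X nu = (1 + rform a k X X - X k * X k / a k) / a k.
  by rewrite -X1 -rform_div//; apply: eq_bigr => i _; rewrite invfM /nu; ring.
have rynu : rform a k y nu = (Q + rform a k X y) / a k.
  have := rform_div a_gt0 a_inj k X y; rewrite yk mulr0 mul0r subr0 => <-.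
  by apply: eq_bigr => i _; rewrite invfM /nu; ring.
have rnunu : rform a k nu nu = (N - X k ^+ 2 / a k ^+ 2 + rform a k X nu) / a k.
  have -> : N = X k ^+ 2 / a k ^+ 2 + \sum_(j | j != k) X j ^+ 2 / a j ^+ 2.
    by rewrite /N /nform (bigD1 k).
  rewrite [X in (X + _) / _]addrAC subrr add0r /rform -big_split /= mulr_suml.
  apply: eq_bigr => j jk; have akj : a k - a j != 0.
    by rewrite subr_eq0 (inj_eq a_inj) eq_sym.
  by rewrite /nu; field; rewrite akj !a0.
rewrite /integral_at /qpform /pform !rformB.
rewrite (rformC (fun i => y i - _)) rformB (rformC (fun i => y i - _)) rformB.
rewrite (rformC nu y) rnunu rynu rXnu yk /nu.
by field; rewrite N0 a0.
Qed.

(** On the projection of [e_i + t e_j] to the tangent space, [integral_at_proj] makes the integral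
    [X_k^2] times the polynomial [p + 2 q t + r t^2], whose extreme coefficients have opposite
    signs. *)
Lemma isotropic_tangent (X : I -> R) (i j k : I) :
  qform a X X = 1 -> X k != 0 -> a i < a k < a j ->
  exists Y, [/\ qform a X Y = 0, integral_at a k X Y = 0 & exists m, Y m != 0].
Proof.
move=> X1 Xk /andP[aik akj].
have N0 : 0 < nform a X by exact: nform_gt0.
have N0' : nform a X != 0 by rewrite gt_eqF.
have a0 := a_neq0 a_gt0.
have ki : k != i by apply: contraTneq aik => ->; rewrite ltxx.
have kj : k != j by apply: contraTneq akj => ->; rewrite ltxx.
have ij : i != j by apply: contraTneq (lt_trans aik akj) => ->; rewrite ltxx.
have nE m : X m ^+ 2 / a m ^+ 2 <= nform a X.
  rewrite /nform (bigD1 m)//= lerDl sumr_ge0// => l _.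
  by rewrite divr_ge0 ?sqr_ge0.
pose N := nform a X.
pose p := (a k - a i)^-1 - X i ^+ 2 / (a i ^+ 2 * (a k * N)).
pose q := - (X i * X j / (a i * a j * (a k * N))).
pose r := (a k - a j)^-1 - X j ^+ 2 / (a j ^+ 2 * (a k * N)).
(* Since [X_i^2 / a_i^2 <= N], the subtracted term is at most [1 / a_k], which is smaller than
   [1 / (a_k - a_i)]. *)
have p0 : 0 < p.
  rewrite subr_gt0 (@le_lt_trans _ _ (a k)^-1)//.
    have -> : X i ^+ 2 / (a i ^+ 2 * (a k * N)) = X i ^+ 2 / a i ^+ 2 / N / a k.
      by field; rewrite N0' !a0.
    by rewrite ler_piMl ?invr_ge0 ?(ltW (a_gt0 k))// ler_pdivrMr// mul1r.
  by rewrite ltf_pV2 ?posrE ?subr_gt0// gtrBl.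
have r0 : r < 0.
  rewrite subr_lt0 (@lt_le_trans _ _ 0)// ?invr_lt0 ?subr_lt0//.
  by rewrite divr_ge0 ?sqr_ge0// !mulr_ge0 ?sqr_ge0 ?ltW.
have [t tE] := quadratic_root q p0 r0.
pose y m : R := (m == i)%:R + t * (m == j)%:R.
have yk : y k = 0 by rewrite /y (negbTE ki) (negbTE kj) mulr0 addr0.
have yi : y i = 1 by rewrite /y eqxx (negbTE ij) mulr0 addr0.
have yj : y j = t by rewrite /y eqxx eq_sym (negbTE ij) mulr1 add0r.
have y0 m : m != i -> m != j -> y m = 0.
  by move=> /negbTE mi /negbTE mj; rewrite /y mi mj mulr0 addr0.
have Qy : qform a X y = X i / a i + t * (X j / a j).
  rewrite /qform (bigD1 i)//= (bigD1 j) 1?eq_sym//= yi yj big1 => [|m].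
    by ring.
  by case/andP=> mi mj; rewrite y0// mulr0 mul0r.
have ryy : rform a k y y = (a k - a i)^-1 + t ^+ 2 / (a k - a j).
  rewrite /rform (bigD1 i) 1?eq_sym//= (bigD1 j) /=; last first.
    by rewrite ![j == _]eq_sym kj.
  rewrite yi yj big1 => [|m]; first by ring.
  by case/andP=> /andP[_ mi] mj; rewrite y0// mulr0 mul0r.
exists (fun m => y m - qform a X y / N * (X m / a m)); split.
- have -> : qform a X (fun m => y m - qform a X y / N * (X m / a m)) =
    qform a X y - qform a X y / N * N.
    rewrite {1 3}/qform /N /nform mulr_sumr -sumrB; apply: eq_bigr => m _.
    by field; rewrite N0' a0.
  by rewrite divfK// subrr.
- rewrite integral_at_proj// -/N (_ : rform a k y y - _ = 0) ?mulr0//.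
  rewrite ryy Qy -tE /p /q /r.
  have aki : a k - a i != 0 by rewrite subr_eq0 (inj_eq a_inj).
  have akj' : a k - a j != 0 by rewrite subr_eq0 (inj_eq a_inj).
  by field; rewrite N0' aki akj' !a0.
(* If the projection changes nothing, coordinate [i] is 1; otherwise coordinate [k] is a nonzero
   multiple of [X k]. *)
- have [c0|c0] := eqVneq (qform a X y / N) 0.
    by exists i; rewrite c0 mul0r subr0 yi oner_neq0.
  by exists k; rewrite yk sub0r oppr_eq0 mulf_neq0// mulf_neq0// invr_neq0.
Qed.

End IsotropicDirection.

(** * Uniform bounds along geodesics of given speed *)

Section FlowBounds.
Context {R : realType} {I : finType}.
Variables (a : I -> R) (lo hi : R).
Hypothesis lo_gt0 : 0 < lo.
Hypothesis hi_gt0 : 0 < hi.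
Hypothesis a_bounds : forall i, lo <= a i <= hi.

Lemma bounds_gt0 i : 0 < a i.
Proof. by have /andP[/(lt_le_trans lo_gt0)] := a_bounds i. Qed.

Let a_gt0 := bounds_gt0.

(** This is a mean of the [1 / a_i], with weights [X_i^2 / a_i] of sum 1. *)
Lemma nform_bounds (X : I -> R) : qform a X X = 1 ->
  hi^-1 <= nform a X <= lo^-1.
Proof.
move=> X1; apply/andP; split.
  rewrite -[leLHS]mulr1 -X1 /qform /nform mulr_sumr.
  apply: ler_sum => i _.
all: [> | rewrite -[leRHS]mulr1 -X1 /qform /nform mulr_sumr;
  apply: ler_sum => i _].
all: have /andP[ai1 ai2] := a_bounds i.
all: have -> : X i ^+ 2 / a i ^+ 2 = (a i)^-1 * (X i * X i / a i)
  by rewrite expr2 invfM; ring.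
all: rewrite ler_wpM2r ?divr_ge0 -?expr2 ?sqr_ge0 ?(ltW (a_gt0 i))//.
all: by rewrite lef_pV2// posrE.
Qed.

Lemma qform_bounds (Y : I -> R) :
  (\sum_i Y i ^+ 2) / hi <= qform a Y Y <= (\sum_i Y i ^+ 2) / lo.
Proof.
rewrite /qform !mulr_suml; apply/andP; split; apply: ler_sum => i _.
all: have /andP[ai1 ai2] := a_bounds i.
all: rewrite -expr2 ler_wpM2l ?sqr_ge0//.
all: by rewrite lef_pV2// posrE.
Qed.

Lemma coord_bound (X : I -> R) i : qform a X X = 1 -> X i ^+ 2 <= a i.
Proof.
move=> X1; rewrite -[leRHS]mul1r -ler_pdivrMr// -X1 /qform (bigD1 i)//= -expr2.
rewrite lerDl sumr_ge0// => j _; rewrite -expr2 divr_ge0 ?sqr_ge0//.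
exact: ltW.
Qed.

Variables (x v : I -> R -> R) (g : R -> R) (T : R).
Hypothesis xvg : string_flow a x v g.
Hypothesis speed0 : \sum_i v i 0 ^+ 2 = T ^+ 2.

Lemma flow_speedT t : \sum_i v i t ^+ 2 = T ^+ 2.
Proof. by rewrite (flow_speed xvg). Qed.

Lemma flow_velocity_bound i t : v i t ^+ 2 <= T ^+ 2.
Proof.
rewrite -(flow_speedT t) (bigD1 i)//= lerDl sumr_ge0// => j _.
exact: sqr_ge0.
Qed.

Lemma flow_curvature_bounds t : T ^+ 2 * lo / hi <= g t <= T ^+ 2 * hi / lo.
Proof.
have [_ _ x1 gE] := xvg.
have N0 : 0 < nform a (x ^~ t) by apply: nform_gt0.
have /andP[n1 n2] := nform_bounds (x1 t).
have /andP[q1 q2] := qform_bounds (v ^~ t).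
rewrite flow_speedT in q1 q2.
have gE' : g t = qform a (v ^~ t) (v ^~ t) / nform a (x ^~ t).
  by rewrite -gE mulfK// gt_eqF.
have i1 : lo <= (nform a (x ^~ t))^-1.
  by rewrite -[lo]invrK lef_pV2// posrE// invr_gt0.
have i2 : (nform a (x ^~ t))^-1 <= hi.
  by rewrite -[hi]invrK lef_pV2// posrE invr_gt0.
have T2 := sqr_ge0 T.
have q0 : 0 <= qform a (v ^~ t) (v ^~ t).
  by apply: le_trans q1; rewrite divr_ge0// ltW.
rewrite gE' ![T ^+ 2 * _ / _]mulrAC; apply/andP; split; apply: ler_pM => //.
- by rewrite divr_ge0// ltW.
- exact: ltW.
- by rewrite invr_ge0 ltW.
Qed.

Lemma coord_energy_derive k (t : R) :
  is_derive t 1 (fun s => x k s ^+ 2 + v k s ^+ 2)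
    (2 * x k t * v k t * (1 - g t / a k)).
Proof. by have [dx dv _ _] := xvg; derive_rules; ring. Qed.

(** An upper bound for [|1 - g / a_k|]. It depends on [lo], [hi] and [T] only, so that the size of a
    perturbation can be fixed before the geodesic is known. *)
Definition energy_rate : R := 1 + T ^+ 2 * hi / lo / lo.

Lemma coord_energy_rate k t :
  `|2 * x k t * v k t * (1 - g t / a k)| <=
  energy_rate * (x k t ^+ 2 + v k t ^+ 2).
Proof.
rewrite normrM mulrC ler_pM//.
  rewrite (le_trans (ler_normB _ _))// normr1 lerD2l.
  have /andP[g1 g2] := flow_curvature_bounds t.
  have /andP[a1 a2] := a_bounds k.
  have g0 : 0 <= g t.
    by apply: le_trans g1; rewrite divr_ge0 ?(ltW hi_gt0)// mulr_ge0 ?sqr_ge0 ?(ltW lo_gt0).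
  rewrite ger0_norm ?divr_ge0 ?(ltW (a_gt0 k))// ler_pM ?invr_ge0//.
    exact: ltW.
  by rewrite lef_pV2// posrE.
rewrite ler_norml; apply/andP; split; rewrite -subr_ge0.
  by rewrite (_ : _ - _ = (x k t + v k t) ^+ 2) ?sqr_ge0//; ring.
by rewrite (_ : _ - _ = (x k t - v k t) ^+ 2) ?sqr_ge0//; ring.
Qed.

Lemma coord_energy_le k t : 0 <= t ->
  x k t ^+ 2 + v k t ^+ 2 <=
  (x k 0 ^+ 2 + v k 0 ^+ 2) * expR (energy_rate * t).
Proof.
move=> t0; have := gronwall_le (k := energy_rate) (coord_energy_derive k) t0.
rewrite subr0; apply => s _.
exact: le_trans (ler_norm _) (coord_energy_rate k s).
Qed.

Lemma coord_energy_gt0 k t : 0 < x k 0 ^+ 2 + v k 0 ^+ 2 ->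
  0 < x k t ^+ 2 + v k t ^+ 2.
Proof.
move=> e0; have [t0|t0] := leP 0 t.
  apply: lt_le_trans (gronwall_ge (k := - energy_rate)
    (coord_energy_derive k) t0 _).
    by rewrite mulr_gt0 ?expR_gt0.
  move=> s _; rewrite mulNr lerNl (le_trans _ (coord_energy_rate k s))//.
  by rewrite -normrN ler_norm.
have := gronwall_le (k := energy_rate) (coord_energy_derive k) (ltW t0).
move=> /(_ _)/(lt_le_trans e0); rewrite pmulr_lgt0 ?expR_gt0//; apply.
move=> s _; exact: le_trans (ler_norm _) (coord_energy_rate k s).
Qed.

(** Uniqueness for [x_k'' = - (g / a_k) x_k], from the energy estimates in both time directions. It
    confines geodesics to coordinate subspaces. *)
Lemma coord_eq0 k t : x k 0 = 0 -> v k 0 = 0 -> x k t = 0 /\ v k t = 0.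
Proof.
move=> x0 v0; suff : x k t ^+ 2 + v k t ^+ 2 <= 0.
  rewrite le_eqVlt ltNge addr_ge0 ?sqr_ge0//= orbF.
  by rewrite paddr_eq0 ?sqr_ge0// !sqrf_eq0 => /andP[/eqP-> /eqP->].
have [t0|t0] := leP 0 t.
  by have := coord_energy_le k t0; rewrite x0 v0 !expr0n addr0 mul0r.
have := gronwall_ge (k := - energy_rate) (coord_energy_derive k) (ltW t0).
rewrite x0 v0 !expr0n addr0 pmulr_lle0 ?expR_gt0//; apply=> s _.
rewrite mulNr lerNl (le_trans _ (coord_energy_rate k s))//.
by rewrite -normrN ler_norm.
Qed.

End FlowBounds.

(** * Isotropic geodesics *)

Section IsotropicDrift.
Context {R : realType} {I : finType}.
Variables (a : I -> R) (lo hi : R).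
Hypothesis lo_gt0 : 0 < lo.
Hypothesis hi_gt0 : 0 < hi.
Hypothesis a_bounds : forall i, lo <= a i <= hi.
Hypothesis a_inj : injective a.

Let a_gt0 := bounds_gt0 lo_gt0 a_bounds.

Section Drift.
Variables (x v : I -> R -> R) (g : R -> R) (T : R).
Hypothesis xvg : string_flow a x v g.
Hypothesis speed0 : \sum_i v i 0 ^+ 2 = T ^+ 2.
Variable k : I.
Hypothesis xk0 : x k 0 != 0.
Hypothesis isotropic : integral_at a k (x ^~ 0) (v ^~ 0) = 0.

Let P t := pform a k (x ^~ t) (v ^~ t).
Let Q t := qpform a k (x ^~ t) (v ^~ t).
Let E t := x k t ^+ 2 + v k t ^+ 2.
(* Since x k * Q = v k * P, the vectors (P, Q) and (x k, v k) are
   proportional, and this is the ratio. *)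
Let S t := (P t * x k t + Q t * v k t) / E t.

Let E_neq0 t : E t != 0.
Proof.
rewrite gt_eqF// (coord_energy_gt0 lo_gt0 hi_gt0 a_bounds xvg speed0)//.
by rewrite ltr_wpDr ?sqr_ge0// lt_neqAle eq_sym sqrf_eq0 xk0 sqr_ge0.
Qed.

Let PQ_ratio t : P t = S t * x k t /\ Q t = S t * v k t.
Proof.
have := flow_integral_at a_gt0 xvg a_inj k t.
rewrite isotropic /integral_at => /eqP; rewrite subr_eq0 -/(P t) -/(Q t).
move=> /eqP xQ; rewrite /S; split.
  have -> : (P t * x k t + Q t * v k t) / E t * x k t =
    (P t * x k t ^+ 2 + (x k t * Q t) * v k t) / E t by ring.
  by rewrite xQ; move: (E_neq0 t); rewrite /E => e0; field.
have -> : (P t * x k t + Q t * v k t) / E t * v k t =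
  (x k t * (v k t * P t) + Q t * v k t ^+ 2) / E t by ring.
by rewrite -xQ; move: (E_neq0 t); rewrite /E => e0; field.
Qed.

(** The common linear system cancels and leaves the factor of the remainders. Dividing by [E], and
    not by [x k], keeps [S] differentiable where the coordinate vanishes between two returns. *)
Let S_derive (t : R) : is_derive t 1 S (g t / a k ^+ 2 * x k t ^+ 2).
Proof.
have [dx dv _ _] := xvg.
have dE := coord_energy_derive xvg k.
have dEV := is_derive1V (E_neq0 t) (dE t).
have dP := flow_pform a_gt0 xvg a_inj k.
have dQ := flow_qpform a_gt0 xvg a_inj k.
rewrite /S; derive_rules.
rewrite -/(P t) -/(Q t).
have [PE QE] := PQ_ratio t; move: PE QE (E_neq0 t); set s := S t => -> -> e0.
have eE : E t = x k t ^+ 2 + v k t ^+ 2 by [].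
by rewrite eE in e0 *; field; rewrite e0 a_neq0.
Qed.

(** Completing the square gives [(x_k^2)' >= - (x_k^2 + v_k^2)], where [x_k^2 <= hi] and
    [v_k^2 <= T^2]. *)
Let coord_lower t : 0 <= t ->
  x k 0 ^+ 2 - (hi + T ^+ 2) * t <= x k t ^+ 2.
Proof.
move=> t0; rewrite lerBlDr.
have d (s : R) : is_derive s 1 (fun s => x k s ^+ 2 + (hi + T ^+ 2) * s)
    (2 * x k s * v k s + (hi + T ^+ 2)).
  have [dx _ _ _] := xvg; have := @is_derive1_id R => did.
  by derive_rules; ring.
have /= := le_of_ge0_derive d t0; rewrite mulr0 addr0; apply => s _.
have [_ _ x1 _] := xvg.
have xs : x k s ^+ 2 <= hi.
  have /andP[_] := a_bounds k; apply: le_trans.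
  exact: (coord_bound lo_gt0 a_bounds k (x1 s)).
have vs := flow_velocity_bound xvg speed0 k s.
have := sqr_ge0 (x k s + v k s); rewrite sqrrD => h.
by move: xs vs h; lra.
Qed.

(** The first factor bounds [g / a_k^2] below. With [C = hi + T^2], the second is the integral of
    [X^2 - C t] from 0 to its zero. The value depends only on [T] and [X], hence is the same for all
    loops. *)
Definition drift_gap (T X : R) : R :=
  T ^+ 2 * lo / hi / hi ^+ 2 * (X ^+ 4 / (2 * (hi + T ^+ 2))).

Lemma isotropic_drift : x k 1 = x k 0 ->
  P 0 / x k 0 + drift_gap T (x k 0) <= P 1 / x k 0.
Proof.
move=> xk1; pose C := hi + T ^+ 2; pose G := T ^+ 2 * lo / hi / hi ^+ 2.
have C0 : 0 < C by rewrite ltr_wpDr ?sqr_ge0.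
have g0 : 0 <= T ^+ 2 * lo / hi.
  by rewrite divr_ge0 ?(ltW hi_gt0)// mulr_ge0 ?sqr_ge0 ?(ltW lo_gt0).
have G0 : 0 <= G by rewrite /G divr_ge0// sqr_ge0.
have gG t : G <= g t / a k ^+ 2.
  have /andP[g1 _] :=
    flow_curvature_bounds lo_gt0 hi_gt0 a_bounds xvg speed0 t.
  have /andP[_ ak] := a_bounds k.
  rewrite /G; apply: ler_pM; rewrite ?invr_ge0 ?sqr_ge0//.
  by rewrite lef_pV2 ?posrE ?exprn_gt0// ler_sqr ?nnegrE ?(ltW hi_gt0) ?(ltW (a_gt0 k))//.
(* The time when the bound of [coord_lower] reaches zero. The whole gap is gained before [tau];
   afterwards the monotonicity of [S] suffices. *)
pose tau := x k 0 ^+ 2 / C.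
have tau0 : 0 <= tau by rewrite divr_ge0 ?sqr_ge0 ?ltW.
have tau1 : tau <= 1.
  have [_ _ x1 _] := xvg; rewrite ler_pdivrMr// mul1r.
  have := coord_bound lo_gt0 a_bounds k (x1 0) => /le_trans; apply.
  have /andP[_ /le_trans] := a_bounds k; apply.
  by rewrite lerDl sqr_ge0.
have d (t : R) : is_derive t 1
    (fun s => S s - G * (x k 0 ^+ 2 * s - C / 2 * s ^+ 2))
    (g t / a k ^+ 2 * x k t ^+ 2 - G * (x k 0 ^+ 2 - C * t)).
  have did := @is_derive1_id R; have dS := S_derive.
  by derive_rules; field; exact: a_neq0.
have h1 : S 0 + drift_gap T (x k 0) <= S tau.
  have := le_of_ge0_derive d tau0.
  rewrite /= !mulr0 expr0n /= !mulr0 subrr mulr0 subr0.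
  have -> : drift_gap T (x k 0) =
      G * (x k 0 ^+ 2 * tau - C / 2 * tau ^+ 2).
    by rewrite /drift_gap -/C -/G /tau; field; rewrite gt_eqF.
  rewrite lerBrDr; apply => t /andP[t0 _]; rewrite subr_ge0.
  apply: le_trans (ler_wpM2l G0 (coord_lower t0)) _.
  by rewrite ler_wpM2r ?sqr_ge0.
have h2 : S tau <= S 1.
  apply: (le_of_ge0_derive S_derive tau1) => t _.
  by rewrite mulr_ge0 ?sqr_ge0// (le_trans G0).
have [-> _] := PQ_ratio 0; have [-> _] := PQ_ratio 1.
by rewrite xk1 !mulfK//; exact: le_trans h2.
Qed.

End Drift.

(** Loops are run in unit time at speed [T]. Only the position returns; the final velocity is left
    free. *)
Definition focal (X : I -> R) (T : R) : Prop :=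
  forall Y : I -> R, qform a X Y = 0 -> \sum_i Y i ^+ 2 = T ^+ 2 ->
  exists x v g, [/\ string_flow a x v g,
    (x ^~ 0) = X, (v ^~ 0) = Y & (x ^~ 1) = X].

(** The final velocity of an isotropic loop is again tangent at [X], isotropic and of length [T], so
    it launches another loop. After [n] loops the ratio [Sf] has gained [n] times the gap, against
    its bound [B] on vectors of length [T]. *)
Lemma focal_middle_coord (X : I -> R) (T : R) (i j k : I) :
  qform a X X = 1 -> 0 < T -> focal X T -> a i < a k < a j -> X k = 0.
Proof.
move=> X1 T0 foc aikj; apply/eqP/negPn/negP => Xk.
have [Y0 [Y0t Y0i [m Ym]]] := isotropic_tangent a_gt0 a_inj X1 Xk aikj.
pose n2 := \sum_i Y0 i ^+ 2.
have n2_gt0 : 0 < n2.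
  rewrite /n2 (bigD1 m)//= ltr_wpDr//; last first.
    by rewrite lt_neqAle eq_sym sqrf_eq0 Ym sqr_ge0.
  by apply: sumr_ge0 => l _; exact: sqr_ge0.
pose c := T / Num.sqrt n2; pose Y := fun i => c * Y0 i.
have Yt : qform a X Y = 0.
  rewrite -(mulr0 c) -Y0t /qform mulr_sumr; apply: eq_bigr => l _.
  by rewrite /Y; ring.
have Yn : \sum_i Y i ^+ 2 = T ^+ 2.
  rewrite /Y; under eq_bigr do rewrite exprMn.
  rewrite -mulr_sumr -/n2 /c exprMn exprVn sqr_sqrtr ?ltW//.
  by rewrite divfK// gt_eqF.
have Yi : integral_at a k X Y = 0.
  rewrite -(mulr0 (c ^+ 2)) -Y0i /integral_at /qpform /pform /Y !rform_scale.
  rewrite (rformC a (fun i => c * Y0 i)) rform_scale; ring.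
pose Sf Z := pform a k X Z / X k.
have del0 : 0 < drift_gap T (X k).
  have T2 : 0 < T ^+ 2 by exact: exprn_gt0.
  apply: mulr_gt0; apply: divr_gt0; rewrite ?(exprn_gt0 _ hi_gt0)//.
  - by rewrite divr_gt0// mulr_gt0.
  - by rewrite exprn_even_gt0.
  - by rewrite mulr_gt0// addr_gt0.
have drift n : exists Z, [/\ qform a X Z = 0, \sum_i Z i ^+ 2 = T ^+ 2,
    integral_at a k X Z = 0 & Sf Y + drift_gap T (X k) *+ n <= Sf Z].
  elim: n => [|n [Z [Zt Zn Zi ZS]]].
    by exists Y; rewrite mulr0n addr0.
  have [x [v [g [xvg x0 v0 x1]]]] := foc Z Zt Zn.
  have e0 l : x l 0 = X l by rewrite -x0.
  have e1 l : x l 1 = X l by rewrite -x1.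
  have sp : \sum_i v i 0 ^+ 2 = T ^+ 2 by rewrite -Zn -v0.
  have xk0 : x k 0 != 0 by rewrite e0.
  have iso : integral_at a k (x ^~ 0) (v ^~ 0) = 0 by rewrite x0 v0.
  exists (v ^~ 1); split.
  - by rewrite -x1 (flow_tangent xvg).
  - by rewrite (flow_speedT xvg sp).
  - by rewrite -iso -(flow_integral_at a_gt0 xvg a_inj k 1) x1.
  - have := isotropic_drift xvg sp xk0 iso; rewrite x0 v0 x1 !e0 e1 => /(_ erefl).
    by rewrite -/(Sf _) -/(Sf _) mulrSr addrA; apply: le_trans; rewrite lerD2r.
pose B := T * (\sum_(j | j != k) `|X j / (a k - a j)|) +
  `|(1 + rform a k X X) / X k| * T.
have bounded Z : \sum_i Z i ^+ 2 = T ^+ 2 -> Sf Z <= B.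
  move=> Zn; have Zl l : `|Z l| <= T.
    rewrite -ler_sqr ?nnegrE ?(ltW T0)// real_normK ?num_real// -Zn (bigD1 l)//=.
    by rewrite lerDl sumr_ge0// => *; exact: sqr_ge0.
  have -> : Sf Z = rform a k X Z - (1 + rform a k X X) / X k * Z k.
    by rewrite /Sf /pform; field.
  rewrite lerD//.
    rewrite /rform mulr_sumr; apply: ler_sum => l _.
    rewrite (le_trans (ler_norm _))// mulrAC normrM mulrC.
    by rewrite ler_wpM2r.
  by rewrite (le_trans (ler_norm _))// normrN normrM ler_wpM2l.
have [n nB] : exists n, B - Sf Y < drift_gap T (X k) *+ n.
  exists (Num.bound `|(B - Sf Y) / drift_gap T (X k)|).
  rewrite -mulr_natl -ltr_pdivrMr// (le_lt_trans (ler_norm _))//.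
  by rewrite archi_boundP.
have [Z [_ Zn _ ZS]] := drift n.
by move: nB (le_trans ZS (bounded _ Zn)); rewrite ltNge -lerBrDl => /negbTE ->.
Qed.

End IsotropicDrift.

(** * Geodesics close to the extreme ellipse *)

Section PlanarAlgebra.
Context {R : realType}.
Variables (p q sg rho Th c s y c1 s1 y1 : R).
Hypotheses (sg_gt0 : 0 < sg) (rho_gt0 : 0 < rho).

Let b := sg ^+ 2.
Let a := b - q ^+ 2.
Let d := b + p ^+ 2.
Let l := p * c - q * s.
Let m := p * s + q * c.
(** As [b - a = q^2] and [d - b = p^2], the expression [g p q kap y / (a b d)] equals
    [l y'' - l'' y]. *)
Let kap := q * c * d + p * s * a.
Let om := Th / rho.
Let f := c1 + s * om.
Let h := s1 - c * om.

Hypotheses (a_neq0 : a != 0) (d_neq0 : d != 0).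
Hypothesis ellE : c ^+ 2 + s ^+ 2 + y ^+ 2 / b = 1.
Hypothesis rhoE : rho ^+ 2 = d * c ^+ 2 + a * s ^+ 2 + a * d * y ^+ 2 / b ^+ 2.

Let i := rho^-1.
Let j := (rho + sg)^-1.
Let B1 := Th * p * q * (2 * rho + sg) / sg * i ^+ 3 * j ^+ 2.
Let B2 := 2 * Th * p * q / sg * i * j.

(* The defect in Z' = r Z + y * planar_error.  It vanishes when the geodesic is
   the ellipse y = 0 itself, where c1 = - s om and s1 = c om. *)
Definition planar_error : R :=
  y * (y * (Th ^+ 2 * p * q / b * i ^+ 4 * j ^+ 2 * (2 * sg * rho + b) *
            (kap / b - a * d * m / b ^+ 2)) - B1 * l * a * d * y1 / b ^+ 2) +
  f * (B2 * p - B1 * l * d * c) - h * (B2 * q + B1 * l * a * s).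

Let sg0 : sg != 0. Proof. by rewrite gt_eqF. Qed.
Let rho0 : rho != 0. Proof. by rewrite gt_eqF. Qed.
Let rs0 : rho + sg != 0. Proof. by rewrite gt_eqF// addr_gt0. Qed.

Let I := kap * (rho + sg) ^+ 2 + sg * (2 * rho + sg) * (d - a) * s * c * l -
  p * q * rho ^+ 2 * l - 2 * sg * rho ^+ 2 * (rho + sg) * m.

Let IE : I = y ^+ 2 * ((2 * sg * rho + b) * (kap / b - a * d * m / b ^+ 2)).
Proof.
apply/eqP; rewrite -subr_eq0; apply/eqP.
(* The difference is a combination of the two constraints [rhoE] and [ellE], with multipliers [m]
   and [kap]. *)
transitivity ((2 * sg * rho + b) * (m * (d * c ^+ 2 + a * s ^+ 2 +
  a * d * y ^+ 2 / b ^+ 2 - rho ^+ 2) +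
  kap * (1 - (c ^+ 2 + s ^+ 2 + y ^+ 2 / b)))).
  by rewrite /I /kap /l /m /a /d /b; field.
by rewrite rhoE ellE !subrr !mulr0 addr0 mulr0.
Qed.

(** The left side is the coefficient of [y] in [Z' - r Z], where [Z = l y' - l' y + r l y]. Its
    vanishing along the ellipse says that [l] times the exponential of minus the integral of [r] is
    a Jacobi field there. *)
Lemma planar_identity :
  let g := Th ^+ 2 * a * d / rho ^+ 4 in
  let r := Th * p * q / (sg * rho * (rho + sg)) in
  let drho := (d * c * c1 + a * s * s1 + a * d * y * y1 / b ^+ 2) / rho in
  let dr := - (Th * p * q * (2 * rho + sg) * drho /
               (sg * rho ^+ 2 * (rho + sg) ^+ 2)) in
  - (g / b) * l + g * (p * c / a - q * s / d) + (dr - r ^+ 2) * l +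
    2 * r * (p * c1 - q * s1) = planar_error.
Proof.
move=> g r drho dr.
(* Writing [c1 = f - s om] and [s1 = h + c om] separates the motion along the ellipse, which gives
   [I], from terms linear in the defects [f], [h] and in [y1]. *)
transitivity (Th ^+ 2 * p * q / (b * rho ^+ 4 * (rho + sg) ^+ 2) * I +
  (f * (B2 * p - B1 * l * d * c) - h * (B2 * q + B1 * l * a * s) -
   y * (B1 * l * a * d * y1 / b ^+ 2))).
  have c1E : c1 = f - s * om by rewrite /f addrK.
  have s1E : s1 = h + c * om by rewrite /h subrK.
  move: c1E s1E; move: f h => F H c1E s1E.
  rewrite /g /dr /drho /r /I /B1 /B2 /i /j c1E s1E /om /kap /l /m.
  move: a_neq0 d_neq0; rewrite /d /a /b => a0 d0.
  field.
  by rewrite a0 d0 sg0 rho0 rs0.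
rewrite IE /planar_error -/l -/m -/kap -/f -/h /i /j.
by field; rewrite /b expf_neq0// rho0 rs0.
Qed.

End PlanarAlgebra.

Section NormBounds.
Context {R : realType}.
Implicit Types x y A B : R.

Lemma normM_le x y A B : `|x| <= A -> `|y| <= B -> `|x * y| <= A * B.
Proof. by move=> xA yB; rewrite normrM ler_pM. Qed.

Lemma normD_le x y A B : `|x| <= A -> `|y| <= B -> `|x + y| <= A + B.
Proof. by move=> xA yB; rewrite (le_trans (ler_normD _ _))// lerD. Qed.

Lemma normN_le x A : `|x| <= A -> `|- x| <= A.
Proof. by rewrite normrN. Qed.

Lemma normX_le x A n : `|x| <= A -> `|x ^+ n| <= A ^+ n.
Proof. by move=> xA; rewrite normrX lerXn2r// nnegrE (le_trans _ xA). Qed.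

End NormBounds.

Ltac norm_bound :=
  lazymatch goal with
  | |- is_true (`|_ + _| <= _) => eapply normD_le; norm_bound
  | |- is_true (`|- _| <= _) => eapply normN_le; norm_bound
  | |- is_true (`|_ * _| <= _) => eapply normM_le; norm_bound
  | |- is_true (`|_ ^+ _| <= _) => eapply normX_le; norm_bound
  | H : is_true (`|?x| <= _) |- is_true (`|?x| <= _) => exact H
  | _ => exact: lexx
  end.

(** * Smallness of the error term *)

Section PlanarBounds.
Context {R : realType}.
Variables (p q sg Tmax C : R).
Hypothesis sg_gt0 : 0 < sg.
Let b := sg ^+ 2.
Let a := b - q ^+ 2.
Let d := b + p ^+ 2.
Hypothesis a_gt0 : 0 < a.

(** Each term of [planar_error] contains one of [y], [f], [h], which are of order [eta], and the
    cofactors are bounded because [rho] stays between positive constants. *)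
Lemma planar_error_bound : exists K, forall rho Th c s y c1 s1 y1 eta : R,
  0 < rho -> a <= rho ^+ 2 <= d -> `|Th| <= Tmax -> `|c| <= 1 -> `|s| <= 1 ->
  `|y| <= eta -> `|y1| <= eta -> eta <= 1 ->
  `|c1 + s * (Th / rho)| <= C * eta -> `|s1 - c * (Th / rho)| <= C * eta ->
  `|planar_error p q sg rho Th c s y c1 s1 y1| <= K * eta.
Proof.
have d0 : 0 < d by rewrite ltr_wpDr ?sqr_ge0// exprn_gt0.
have bnd : exists K1 K2 K3, forall rho Th c s y y1 : R,
  `|rho| <= Num.sqrt d -> `|rho^-1| <= (Num.sqrt a)^-1 -> `|(rho + sg)^-1| <= sg^-1 ->
  `|Th| <= Tmax -> `|c| <= 1 -> `|s| <= 1 -> `|y| <= 1 -> `|y1| <= 1 ->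
  let l := p * c - q * s in let m := p * s + q * c in
  let kap := q * c * d + p * s * a in
  let i := rho^-1 in let j := (rho + sg)^-1 in
  let B1 := Th * p * q * (2 * rho + sg) / sg * i ^+ 3 * j ^+ 2 in
  let B2 := 2 * Th * p * q / sg * i * j in
  [/\ `|y * (Th ^+ 2 * p * q / b * i ^+ 4 * j ^+ 2 * (2 * sg * rho + b) *
            (kap / b - a * d * m / b ^+ 2)) - B1 * l * a * d * y1 / b ^+ 2| <= K1,
      `|B2 * p - B1 * l * d * c| <= K2 &
      `|B2 * q + B1 * l * a * s| <= K3].
  (* The constants are existential variables created before [rho], [Th] and the coordinates, so
     [norm_bound] has to build them from the parameters of the section alone. *)
  do 3 eexists; move=> rho Th c s y y1 h1 h2 h3 h4 h5 h6 h7 h8 l m kap i j B1 B2.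
  rewrite /B1 /B2 /kap /l /m /i /j; clear l m kap i j B1 B2.
  by split; norm_bound.
have [K1 [K2 [K3 KE]]] := bnd.
exists (K1 + C * K2 + C * K3) => rho Th c s y c1 s1 y1 eta rho0 /andP[ar rd] Th0.
move=> c_1 s_1 ye y1e e1 fe he.
have rhoE : `|rho| = Num.sqrt (rho ^+ 2) by rewrite sqrtr_sqr.
have h1 : `|rho| <= Num.sqrt d by rewrite rhoE ler_wsqrtr.
have h2 : `|rho^-1| <= (Num.sqrt a)^-1.
  rewrite normfV lef_pV2 ?posrE ?sqrtr_gt0// ?normr_gt0 ?gt_eqF//.
  by rewrite rhoE ler_wsqrtr.
have h3 : `|(rho + sg)^-1| <= sg^-1.
  rewrite gtr0_norm ?invr_gt0 ?addr_gt0// lef_pV2 ?posrE ?addr_gt0//.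
  by rewrite lerDr ltW.
have [k1 k2 k3] := KE rho Th c s y y1 h1 h2 h3 Th0 c_1 s_1
  (le_trans ye e1) (le_trans y1e e1).
rewrite /planar_error.
have -> : (K1 + C * K2 + C * K3) * eta =
  eta * K1 + C * eta * K2 + C * eta * K3 by ring.
apply: normD_le; first by apply: normD_le; exact: normM_le.
exact/normN_le/normM_le.
Qed.

End PlanarBounds.

(** * Growth of the Wronskian near the ellipse *)

Section PlanarDrift.
Context {R : realType}.
Variables p q sg : R.
Hypotheses (p_gt0 : 0 < p) (q_gt0 : 0 < q) (sg_gt0 : 0 < sg).
Let b := sg ^+ 2.
Let a := b - q ^+ 2.
Let d := b + p ^+ 2.
Hypothesis a_gt0 : 0 < a.

Let b_gt0 : 0 < b. Proof. exact: exprn_gt0. Qed.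
Let d_gt0 : 0 < d. Proof. by rewrite addr_gt0// exprn_gt0. Qed.
Let a0 : a != 0. Proof. by rewrite gt_eqF. Qed.
Let b0 : b != 0. Proof. by rewrite gt_eqF. Qed.
Let d0 : d != 0. Proof. by rewrite gt_eqF. Qed.
Let a_le_b : a <= b. Proof. by rewrite lerBlDr lerDl sqr_ge0. Qed.
Let b_le_d : b <= d. Proof. by rewrite lerDl sqr_ge0. Qed.

(* The coordinates are c = x_i / sqrt a, s = x_j / sqrt d and y = x_k, where
   a < b < d are the squared semi-axes. *)
Definition planar_flow (c s y c1 s1 y1 g : R -> R) (J : R) : Prop :=
  [/\ forall t : R, [/\ is_derive t 1 c (c1 t), is_derive t 1 s (s1 t) &
        is_derive t 1 y (y1 t)],
      forall t : R, [/\ is_derive t 1 c1 (- (g t / a) * c t),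
        is_derive t 1 s1 (- (g t / d) * s t) &
        is_derive t 1 y1 (- (g t / b) * y t)],
      forall t, c t ^+ 2 + s t ^+ 2 + y t ^+ 2 / b = 1 /\
        c t * c1 t + s t * s1 t + y t * y1 t / b = 0 &
      forall t, let N := c t ^+ 2 / a + s t ^+ 2 / d + y t ^+ 2 / b ^+ 2 in
        let Q := c1 t ^+ 2 + s1 t ^+ 2 + y1 t ^+ 2 / b in
        g t * N = Q /\ Q * N = J].

Section Flow.
Variables (c s y c1 s1 y1 g : R -> R) (J : R).
Hypothesis flow : planar_flow c s y c1 s1 y1 g J.

Let dc (t : R) : is_derive t 1 c (c1 t). Proof. by case: flow => /(_ t)[]. Qed.
Let ds (t : R) : is_derive t 1 s (s1 t). Proof. by case: flow => /(_ t)[]. Qed.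
Let dy (t : R) : is_derive t 1 y (y1 t). Proof. by case: flow => /(_ t)[]. Qed.
Let dc1 (t : R) : is_derive t 1 c1 (- (g t / a) * c t).
Proof. by case: flow => _ /(_ t)[]. Qed.
Let ds1 (t : R) : is_derive t 1 s1 (- (g t / d) * s t).
Proof. by case: flow => _ /(_ t)[]. Qed.
Let dy1 (t : R) : is_derive t 1 y1 (- (g t / b) * y t).
Proof. by case: flow => _ /(_ t)[]. Qed.
Let ellE t : c t ^+ 2 + s t ^+ 2 + y t ^+ 2 / b = 1.
Proof. by case: flow => _ _ /(_ t)[]. Qed.
Let tanE t : c t * c1 t + s t * s1 t + y t * y1 t / b = 0.
Proof. by case: flow => _ _ /(_ t)[]. Qed.

Let M t := d * c t ^+ 2 + a * s t ^+ 2 + a * d * y t ^+ 2 / b ^+ 2.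
Let N t := c t ^+ 2 / a + s t ^+ 2 / d + y t ^+ 2 / b ^+ 2.
Let Q t := c1 t ^+ 2 + s1 t ^+ 2 + y1 t ^+ 2 / b.
Let rho t := Num.sqrt (M t).
(** For fixed [J], Joachimsthal's integral expresses [g] and the speed by the position:
    [g = Th^2 a d / rho^4] and [Q = om^2]. *)
Let Th := Num.sqrt (J * a * d).
Let om t := Th / rho t.
Let r t := Th * p * q / (sg * rho t * (rho t + sg)).

(** [M] is the mean of [d], [a] and [a d / b], all in [[a, d]], with the weights [c^2], [s^2] and
    [y^2 / b] of sum 1. *)
Let M_bounds t : a <= M t <= d.
Proof.
have M1 : M t = d * c t ^+ 2 + a * s t ^+ 2 + a * d / b * (y t ^+ 2 / b).
  by rewrite /M expr2 invfM; ring.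
have y0 : 0 <= y t ^+ 2 / b by rewrite divr_ge0 ?sqr_ge0 ?ltW.
have adb1 : a <= a * d / b by rewrite -mulrA ler_peMr ?(ltW a_gt0)// ler_pdivlMr ?mul1r.
have adb2 : a * d / b <= d by rewrite mulrAC ler_piMl ?(ltW d_gt0)// ler_pdivrMr ?mul1r.
have ad : a <= d by exact: le_trans b_le_d.
have E k : k = k * c t ^+ 2 + k * s t ^+ 2 + k * (y t ^+ 2 / b).
  by rewrite -!mulrDr ellE mulr1.
rewrite M1; apply/andP; split.
  rewrite [leLHS]E !lerD//.
  - by rewrite ler_wpM2r ?sqr_ge0.
  - by rewrite ler_wpM2r.
rewrite [leRHS]E !lerD//.
- by rewrite ler_wpM2r ?sqr_ge0.
- by rewrite ler_wpM2r.
Qed.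

Let M_gt0 t : 0 < M t.
Proof. by have /andP[/(lt_le_trans a_gt0)] := M_bounds t. Qed.

Let rho_gt0 t : 0 < rho t. Proof. by rewrite sqrtr_gt0. Qed.
Let rho0 t : rho t != 0. Proof. by rewrite gt_eqF. Qed.
Let rhoE t : rho t ^+ 2 = M t. Proof. by rewrite sqr_sqrtr// ltW. Qed.
Let rs0 t : rho t + sg != 0. Proof. by rewrite gt_eqF// addr_gt0. Qed.

Let MN t : M t = a * d * N t.
Proof. by rewrite /M /N; field; rewrite a0 b0 d0. Qed.

Let N_gt0 t : 0 < N t.
Proof. by have := M_gt0 t; rewrite MN pmulr_rgt0// mulr_gt0. Qed.

Let J_ge0 : 0 <= J.
Proof.
have [_ _ _ /(_ 0)[_ <-]] := flow; rewrite mulr_ge0//; last exact: ltW (N_gt0 0).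
by rewrite !addr_ge0 ?sqr_ge0// divr_ge0 ?sqr_ge0// ltW.
Qed.

Let ThE : Th ^+ 2 = J * a * d.
Proof. by rewrite sqr_sqrtr// !mulr_ge0// ltW. Qed.

Let gE t : g t = Th ^+ 2 * a * d / rho t ^+ 4.
Proof.
have [_ _ _ /(_ t)[gN QN]] := flow; move: gN QN.
rewrite -/(N t) -/(Q t) -[rho t ^+ 4]/(rho t ^+ (2 * 2)) exprM rhoE MN ThE => gN QN.
have n0 : N t != 0 by rewrite gt_eqF.
by rewrite -QN -gN; field; rewrite a0 d0 n0.
Qed.

Let omE t : om t ^+ 2 = Q t.
Proof.
have [_ _ _ /(_ t)[_ QN]] := flow; move: QN; rewrite -/(N t) -/(Q t) => QN.
have n0 : N t != 0 by rewrite gt_eqF.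
by rewrite /om exprMn exprVn rhoE MN ThE -QN; field; rewrite a0 d0 n0.
Qed.

Let l t := p * c t - q * s t.
Let Z t := l t * y1 t - (p * c1 t - q * s1 t) * y t + r t * l t * y t.
Let err t := planar_error p q sg (rho t) Th (c t) (s t) (y t) (c1 t) (s1 t) (y1 t).

Let Z_derive (t : R) : is_derive t 1 Z (r t * Z t + y t * err t).
Proof.
pose dM0 s0 := 2 * (d * c s0 * c1 s0 + a * s s0 * s1 s0 +
                a * d * y s0 * y1 s0 / b ^+ 2).
have dM (u : R) : is_derive u 1 M (dM0 u).
  by rewrite /M; derive_rules; rewrite /dM0; ring.
pose drho := (d * c t * c1 t + a * s t * s1 t +
              a * d * y t * y1 t / b ^+ 2) / rho t.
have drhoE : is_derive t 1 rho drho.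
  apply: is_derive1_eq (is_derive1_sqrtf (M_gt0 t) (dM t)) _.
  by rewrite -/(rho t) /drho /dM0; field; rewrite b0 rho0.
have dr : is_derive t 1 r (- (Th * p * q * (2 * rho t + sg) * drho /
               (sg * rho t ^+ 2 * (rho t + sg) ^+ 2))).
  have nz : sg * rho t * (rho t + sg) != 0.
    by rewrite !mulf_neq0// gt_eqF.
  have dden : is_derive t 1 (fun u => sg * rho u * (rho u + sg))
      (sg * (2 * rho t + sg) * drho) by derive_rules; ring.
  have dinv := @is_derive1V _ (fun u => sg * rho u * (rho u + sg)) _ _ nz dden.
  by rewrite /r; derive_rules; field; rewrite rs0 rho0 gt_eqF.
have := planar_identity (p := p) (q := q) Th (c1 t) (s1 t) (y1 t) sg_gt0
  (rho_gt0 t) a0 d0 (ellE t) (rhoE t).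
rewrite /= -/b -/a -/d -/(err t) -gE -/drho -/(r t) => <-.
rewrite /Z /l; derive_rules; rewrite /Z /l; field.
by rewrite rs0 rho0 a0 b0 d0 gt_eqF.
Qed.

Variables (Tmin Tmax C0 eta : R).
Hypothesis Tmin_gt0 : 0 < Tmin.
Hypothesis Th_bounds : Tmin <= Th <= Tmax.
Hypothesis C0E : C0 = (1 + Tmax ^+ 2 / a) / b.
Hypothesis eta_small : eta ^+ 2 * C0 < Tmin ^+ 2 / d.
Hypothesis eta_le1 : eta <= 1.
Hypothesis y_small : forall t, 0 <= t <= 1 -> `|y t| <= eta /\ `|y1 t| <= eta.
Hypothesis positively_oriented : 0 < c 0 * s1 0 - s 0 * c1 0.

Let w t := c t * s1 t - s t * c1 t.

Let Th_gt0 : 0 < Th.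
Proof. by case/andP: Th_bounds => /(lt_le_trans Tmin_gt0). Qed.

Let eta_ge0 : 0 <= eta.
Proof.
have [|h _] := y_small (t := 0); first by rewrite lexx ler01.
exact: le_trans h.
Qed.

Let om_gt0 t : 0 < om t. Proof. by rewrite divr_gt0. Qed.

Let om_lower t : Tmin ^+ 2 / d <= om t ^+ 2.
Proof.
have /andP[t1 _] := Th_bounds; have /andP[_ m2] := M_bounds t.
rewrite /om exprMn exprVn rhoE ler_pM ?invr_ge0 ?sqr_ge0 ?(ltW d_gt0)//.
  by rewrite ler_sqr ?nnegrE ?(ltW Th_gt0) ?(ltW Tmin_gt0).
by rewrite lef_pV2 ?posrE.
Qed.

Let om_upper t : om t ^+ 2 <= Tmax ^+ 2 / a.
Proof.
have /andP[_ t2] := Th_bounds; have /andP[m1 _] := M_bounds t.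
rewrite /om exprMn exprVn rhoE ler_pM ?invr_ge0 ?sqr_ge0 ?(ltW (M_gt0 t))//.
  by rewrite ler_sqr ?nnegrE ?(ltW Th_gt0)// (le_trans (ltW Th_gt0)).
by rewrite lef_pV2 ?posrE.
Qed.

Let sqr_small u : `|u| <= eta -> u ^+ 2 <= eta ^+ 2.
Proof. by move=> ue; rewrite -real_normK ?num_real// ler_sqr ?nnegrE. Qed.

(** Lagrange's identity for [(c, s)] and [(c1, s1)], whose inner product is [- y y1 / b], gives the
    exact value [(y1^2 + y^2 om^2) / b]. *)
Let w_defect t : 0 <= t <= 1 -> 0 <= om t ^+ 2 - w t ^+ 2 <= eta ^+ 2 * C0.
Proof.
move=> t01; have [/sqr_small ye /sqr_small y1e] := y_small t01.
have -> : om t ^+ 2 - w t ^+ 2 = (y1 t ^+ 2 + y t ^+ 2 * om t ^+ 2) / b.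
  have k2 : (c t * c1 t + s t * s1 t) ^+ 2 = (y t * y1 t / b) ^+ 2.
    by rewrite -[RHS]sqrrN; congr (_ ^+ 2); apply/eqP; rewrite -addr_eq0 tanE.
  have n2 : c t ^+ 2 + s t ^+ 2 = 1 - y t ^+ 2 / b by rewrite -(ellE t) addrK.
  have q2 : c1 t ^+ 2 + s1 t ^+ 2 = om t ^+ 2 - y1 t ^+ 2 / b.
    by rewrite omE /Q addrK.
  have -> : w t ^+ 2 = (c t ^+ 2 + s t ^+ 2) * (c1 t ^+ 2 + s1 t ^+ 2) -
    (c t * c1 t + s t * s1 t) ^+ 2 by rewrite /w; ring.
  by rewrite k2 n2 q2; field.
have y2 : 0 <= y t ^+ 2 * om t ^+ 2 by rewrite mulr_ge0 ?sqr_ge0.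
rewrite divr_ge0 ?(ltW b_gt0) ?(addr_ge0 (sqr_ge0 _) y2)//=.
rewrite C0E mulrA ler_wpM2r ?invr_ge0 ?(ltW b_gt0)// mulrDr mulr1 lerD//.
by rewrite ler_pM ?sqr_ge0.
Qed.

(** By [w_defect] and [eta_small], [w] cannot vanish and keeps its initial sign: the geodesic never
    turns back along the ellipse. *)
Let w_gt0 t : 0 <= t <= 1 -> 0 < w t.
Proof.
have dw (u : R) : is_derive u 1 w
    (c u * (- (g u / d) * s u) - s u * (- (g u / a) * c u)).
  by rewrite /w; derive_rules; ring.
apply: (continuous_gt0 (is_derive1_continuous dw) ler01) => // u u01.
have /andP[_ h] := w_defect u01; rewrite -sqrf_eq0 gt_eqF//.
have := lt_le_trans (le_lt_trans h eta_small) (om_lower u).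
by rewrite ltrBlDr ltrDl.
Qed.

Let C := 1 + 2 * C0.

Let C0_ge0 : 0 <= C0.
Proof.
by rewrite C0E divr_ge0 ?(ltW b_gt0)// addr_ge0// divr_ge0 ?sqr_ge0 ?(ltW a_gt0).
Qed.

(** The sum of the two squares is at most [2 om (om - w)]. As [w] is positive, this is at most
    [2 (om^2 - w^2)], which [w_defect] controls. *)
Lemma velocity_defect t : 0 <= t <= 1 ->
  `|c1 t + s t * om t| <= C * eta /\ `|s1 t - c t * om t| <= C * eta.
Proof.
move=> t01; have /andP[w1 w2] := w_defect t01; have w0 := w_gt0 t01.
set f := c1 t + _; set h := s1 t - _.
have wo : w t <= om t by rewrite -ler_sqr ?nnegrE ?(ltW w0) ?(ltW (om_gt0 t))// -subr_ge0.
have fh : f ^+ 2 + h ^+ 2 <= 2 * (om t * (om t - w t)).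
  have -> : f ^+ 2 + h ^+ 2 = c1 t ^+ 2 + s1 t ^+ 2 +
      om t ^+ 2 * (c t ^+ 2 + s t ^+ 2) - 2 * om t * w t.
    by rewrite /f /h /w; ring.
  have -> : c t ^+ 2 + s t ^+ 2 = 1 - y t ^+ 2 / b by rewrite -(ellE t) addrK.
  have -> : c1 t ^+ 2 + s1 t ^+ 2 = om t ^+ 2 - y1 t ^+ 2 / b.
    by rewrite omE /Q addrK.
  rewrite -subr_ge0 (_ : _ - _ = y1 t ^+ 2 / b + om t ^+ 2 * (y t ^+ 2 / b)).
    have y0 (u : R) : 0 <= u ^+ 2 / b by rewrite divr_ge0 ?sqr_ge0 ?(ltW b_gt0).
    by rewrite addr_ge0 ?y0// (mulr_ge0 (sqr_ge0 _) (y0 _)).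
  by ring.
have fh2 : f ^+ 2 + h ^+ 2 <= (C * eta) ^+ 2.
  apply: (le_trans fh); apply: (@le_trans _ _ (2 * (eta ^+ 2 * C0))).
    rewrite ler_pM2l//; apply: le_trans w2.
    rewrite [leRHS](_ : _ = (om t + w t) * (om t - w t)); last by ring.
    by rewrite ler_wpM2r ?subr_ge0// lerDl ltW.
  rewrite exprMn (_ : 2 * (eta ^+ 2 * C0) = 2 * C0 * eta ^+ 2); last by ring.
  rewrite ler_wpM2r ?sqr_ge0// /C -subr_ge0.
  rewrite (_ : _ - _ = 1 + 2 * C0 + 4 * C0 ^+ 2); last by ring.
  by rewrite !addr_ge0// mulr_ge0// sqr_ge0.
have Ce : 0 <= C * eta by rewrite mulr_ge0// addr_ge0// mulr_ge0.
by split; rewrite -ler_sqr ?nnegrE// real_normK ?num_real//;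
  apply: le_trans fh2; rewrite ?lerDl ?lerDr sqr_ge0.
Qed.

Lemma planar_flow_bounds t : 0 <= t <= 1 ->
  [/\ `|c t| <= 1, `|s t| <= 1, `|c1 t| <= 1 + Tmax ^+ 2 / a &
      `|s1 t| <= 1 + Tmax ^+ 2 / a].
Proof.
move=> t01; have y0 (u : R) : 0 <= u ^+ 2 / b by rewrite divr_ge0 ?sqr_ge0 ?(ltW b_gt0).
have [c2 s2] : c t ^+ 2 <= 1 /\ s t ^+ 2 <= 1.
  rewrite -{1 2}(ellE t) -addrA lerDl addr_ge0 ?sqr_ge0//.
  by rewrite addrCA lerDl addr_ge0 ?sqr_ge0.
have [c12 s12] : c1 t ^+ 2 <= Tmax ^+ 2 / a /\ s1 t ^+ 2 <= Tmax ^+ 2 / a.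
  split; apply: le_trans (om_upper t); rewrite omE /Q.
    by rewrite -addrA lerDl addr_ge0 ?sqr_ge0.
  by rewrite -addrA addrCA lerDl addr_ge0 ?sqr_ge0.
have T0 : 0 <= Tmax ^+ 2 / a by rewrite divr_ge0 ?sqr_ge0 ?(ltW a_gt0).
have b1 (u : R) : u ^+ 2 <= 1 -> `|u| <= 1.
  by move=> u1; rewrite -(@expr_le1 _ 2)// -normrX ger0_norm ?sqr_ge0.
have b2 (u : R) : u ^+ 2 <= Tmax ^+ 2 / a -> `|u| <= 1 + Tmax ^+ 2 / a.
  move=> u1; rewrite -ler_sqr ?nnegrE ?addr_ge0// real_normK ?num_real//.
  apply: (le_trans u1); rewrite -subr_ge0.
  rewrite (_ : _ - _ = 1 + Tmax ^+ 2 / a + (Tmax ^+ 2 / a) ^+ 2); last by ring.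
  by rewrite !addr_ge0// sqr_ge0.
by split; auto.
Qed.

(** A lower bound for [r], from [Tmin <= Th] and [rho <= sqrt d]. *)
Definition growth_rate : R :=
  Tmin * p * q / (sg * Num.sqrt d * (Num.sqrt d + sg)).

(** The summands bound [l], [l'] and [r l], the coefficients in [Z]; hence
    [|Z| <= wronskian_bound * eta]. *)
Definition wronskian_bound : R :=
  (p + q) + (p + q) * (1 + Tmax ^+ 2 / a) +
  Tmax * p * q * (sg^-1 * (Num.sqrt a)^-1 * sg^-1) * (p + q).

(** At both ends [y = 0], so [Z^2] has the common value [mu = (l y1)^2]. If the inequality failed,
    then [(Z^2)' >= 2 growth_rate (Z^2 - mu / 2)], and [Z^2 - mu / 2] would grow strictly from its
    positive initial value. *)
Lemma planar_growth K :
  (forall rho Th c s y c1 s1 y1 eta : R,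
    0 < rho -> a <= rho ^+ 2 <= d -> `|Th| <= Tmax -> `|c| <= 1 -> `|s| <= 1 ->
    `|y| <= eta -> `|y1| <= eta -> eta <= 1 ->
    `|c1 + s * (Th / rho)| <= C * eta -> `|s1 - c * (Th / rho)| <= C * eta ->
    `|planar_error p q sg rho Th c s y c1 s1 y1| <= K * eta) ->
  y 0 = 0 -> y 1 = 0 -> (l 1 * y1 1) ^+ 2 = (l 0 * y1 0) ^+ 2 ->
  growth_rate * (l 0 * y1 0) ^+ 2 <= 2 * wronskian_bound * K * eta ^+ 3.
Proof.
move=> KE y00 y10 lE; rewrite leNgt; apply/negP => contra.
pose mu := (l 0 * y1 0) ^+ 2.
have /andP[t1 t2] := Th_bounds.
have Th_norm : `|Th| <= Tmax by rewrite gtr0_norm.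
have rho_lower t : Num.sqrt a <= rho t.
  by rewrite ler_wsqrtr//; case/andP: (M_bounds t).
have rho_upper t : rho t <= Num.sqrt d.
  by rewrite ler_wsqrtr//; case/andP: (M_bounds t).
have sd0 : 0 < Num.sqrt d by rewrite sqrtr_gt0.
have sa0 : 0 < Num.sqrt a by rewrite sqrtr_gt0.
have rate_gt0 : 0 < growth_rate.
  by rewrite /growth_rate divr_gt0 ?mulr_gt0// addr_gt0.
have r_lower t : growth_rate <= r t.
  rewrite /growth_rate /r; apply: ler_pM.
  - by apply/ltW; rewrite !mulr_gt0.
  - by rewrite invr_ge0; apply/ltW; rewrite !mulr_gt0// addr_gt0.
  - by rewrite !ler_pM2r.
  rewrite lef_pV2 ?posrE ?mulr_gt0 ?addr_gt0//; apply: ler_pM.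
  - by apply/ltW; rewrite mulr_gt0.
  - by apply/ltW; rewrite addr_gt0.
  - by rewrite ler_pM2l.
  - by rewrite lerD2r.
have r_upper t : `|r t| <= Tmax * p * q * (sg^-1 * (Num.sqrt a)^-1 * sg^-1).
  rewrite /r !invfM; apply: normM_le.
    by apply: normM_le; [apply: normM_le => //|]; rewrite gtr0_norm.
  apply: normM_le; first apply: normM_le.
  - by rewrite gtr0_norm ?invr_gt0.
  - by rewrite gtr0_norm ?invr_gt0// lef_pV2 ?posrE.
  - rewrite gtr0_norm ?invr_gt0 ?addr_gt0// lef_pV2 ?posrE ?addr_gt0//.
    by rewrite lerDr ltW.
have Z_bound t : 0 <= t <= 1 -> `|Z t| <= wronskian_bound * eta.
  move=> t01; have [c_1 s_1 c1_V s1_V] := planar_flow_bounds t01.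
  have [ye y1e] := y_small t01.
  have pp : `|p| <= p by rewrite gtr0_norm.
  have qq : `|q| <= q by rewrite gtr0_norm.
  have lt_ : `|l t| <= p + q.
    rewrite -[p in leRHS]mulr1 -[q in leRHS]mulr1.
    by apply: normD_le; [|apply: normN_le]; exact: normM_le.
  have l1t : `|p * c1 t - q * s1 t| <= (p + q) * (1 + Tmax ^+ 2 / a).
    by rewrite mulrDl; apply: normD_le; [|apply: normN_le]; exact: normM_le.
  have -> : wronskian_bound * eta = (p + q) * eta +
      (p + q) * (1 + Tmax ^+ 2 / a) * eta +
      Tmax * p * q * (sg^-1 * (Num.sqrt a)^-1 * sg^-1) * (p + q) * eta.
    by rewrite -!mulrDl.
  apply: normD_le; first (apply: normD_le; last apply: normN_le).
  - exact: normM_le.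
  - exact: normM_le.
  - by apply: normM_le => //; exact: normM_le.
have err_bound t : 0 <= t <= 1 -> `|err t| <= K * eta.
  move=> t01; have [c_1 s_1 _ _] := planar_flow_bounds t01.
  have [ye y1e] := y_small t01.
  have [fe he] := velocity_defect t01.
  by apply: KE => //; rewrite rhoE.
have dZ2 (t : R) : is_derive t 1 (fun u => Z u ^+ 2 - mu / 2)
    (2 * Z t * (r t * Z t + y t * err t)).
  have dZ := Z_derive; derive_rules; ring.
have Z0 : Z 0 ^+ 2 = mu by rewrite /Z y00 !mulr0 subr0 addr0.
have Z1 : Z 1 ^+ 2 = mu by rewrite /Z y10 !mulr0 subr0 addr0.
have := @gronwall_ge _ _ _ (2 * growth_rate) 0 1 dZ2 ler01.
rewrite /= Z0 Z1 subr0 mulr1 leNgt => /(_ _)/negP; apply.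
  move=> t t01.
  have hr : growth_rate * Z t ^+ 2 <= r t * Z t ^+ 2.
    by rewrite ler_wpM2r ?sqr_ge0.
  have [ye _] := y_small t01.
  have hZ : `|Z t * (y t * err t)| <= wronskian_bound * eta * (eta * (K * eta)).
    apply: normM_le; [exact: Z_bound|apply: normM_le => //].
    exact: err_bound.
  have := ler_norm (- (Z t * (y t * err t))); rewrite normrN => /le_trans/(_ hZ).
  by move: contra hr; rewrite -/mu; nra.
have mu0 : 0 < mu.
  rewrite lt_neqAle sqr_ge0 andbT eq_sym; apply/eqP => mu0.
  have e0 : 0 <= 2 * wronskian_bound * K * eta ^+ 3.
    have := err_bound 0; have := Z_bound 0; rewrite lexx ler01.
    move=> /(_ isT) h1 /(_ isT) h2.
    have := mulr_ge0 (mulr_ge0 (le_trans (normr_ge0 _) h1)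
      (le_trans (normr_ge0 _) h2)) eta_ge0.
    by lra.
  by move: contra; rewrite -/mu mu0 mulr0 ltNge e0.
have -> : mu - mu / 2 = mu / 2 by field.
by rewrite ltr_pMr ?divr_gt0// expR_gt1 mulr_gt0.
Qed.

End Flow.
End PlanarDrift.

(** * Focal points on the extreme ellipse *)

Section FocalPlane.
Context {R : realType} {I : finType}.
Variable a : I -> R.
Variables i j k : I.
Hypothesis ai_gt0 : 0 < a i.
Hypothesis a_bounds : forall m, a i <= a m <= a j.
Hypothesis a_inj : injective a.
Hypothesis aikj : a i < a k < a j.

Let a_gt0 := bounds_gt0 ai_gt0 a_bounds.
Let aj_gt0 : 0 < a j. Proof. exact: a_gt0. Qed.
Let ak_gt0 : 0 < a k. Proof. exact: a_gt0. Qed.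
Let ik : i != k.
Proof. by case/andP: aikj => h _; apply: contraTneq h => ->; rewrite ltxx. Qed.
Let jk : j != k.
Proof. by case/andP: aikj => _ h; apply: contraTneq h => ->; rewrite ltxx. Qed.
Let ij : i != j.
Proof.
case/andP: aikj => h1 h2.
by apply: contraTneq (lt_trans h1 h2) => ->; rewrite ltxx.
Qed.

Lemma sum3 (F : I -> R) : (forall m, m != i -> m != j -> m != k -> F m = 0) ->
  \sum_m F m = F i + F j + F k.
Proof.
move=> F0; rewrite (bigD1 i)//= (bigD1 j) 1?eq_sym//= (bigD1 k)/=; last first.
  by rewrite ![k == _]eq_sym ik.
rewrite big1 => [|m /andP[/andP[mi mj] mk]]; last exact: F0.
by rewrite addr0 !addrA.
Qed.

Let p := Num.sqrt (a j - a k).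
Let q := Num.sqrt (a k - a i).
Let sg := Num.sqrt (a k).
Let ra := Num.sqrt (a i).
Let rd := Num.sqrt (a j).

Let p_gt0 : 0 < p. Proof. by rewrite sqrtr_gt0 subr_gt0; case/andP: aikj. Qed.
Let q_gt0 : 0 < q. Proof. by rewrite sqrtr_gt0 subr_gt0; case/andP: aikj. Qed.
Let sg_gt0 : 0 < sg. Proof. by rewrite sqrtr_gt0. Qed.
Let sgE : sg ^+ 2 = a k. Proof. by rewrite sqr_sqrtr// ltW. Qed.
Let aE : sg ^+ 2 - q ^+ 2 = a i.
Proof.
rewrite sgE sqr_sqrtr; first by ring.
by rewrite subr_ge0 ltW//; case/andP: aikj.
Qed.
Let dE : sg ^+ 2 + p ^+ 2 = a j.
Proof.
rewrite sgE sqr_sqrtr; first by ring.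
by rewrite subr_ge0 ltW//; case/andP: aikj.
Qed.
Let raE : ra ^+ 2 = a i. Proof. by rewrite sqr_sqrtr// ltW. Qed.
Let rdE : rd ^+ 2 = a j. Proof. by rewrite sqr_sqrtr// ltW. Qed.
Let ra0 : ra != 0. Proof. by rewrite gt_eqF// sqrtr_gt0. Qed.
Let rd0 : rd != 0. Proof. by rewrite gt_eqF// sqrtr_gt0. Qed.

(** By [coord_eq0] the geodesic stays in the space of the axes [i], [j], [k]; [J] is the value of
    Joachimsthal's integral. *)
Lemma planar_flow_of_string (x v : I -> R -> R) (g : R -> R) (T : R) :
  string_flow a x v g -> \sum_m v m 0 ^+ 2 = T ^+ 2 ->
  (forall m, m != i -> m != j -> m != k -> x m 0 = 0 /\ v m 0 = 0) ->
  planar_flow p q sg (fun t => x i t / ra) (fun t => x j t / rd) (x k)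
    (fun t => v i t / ra) (fun t => v j t / rd) (v k) g
    (qform a (v ^~ 0) (v ^~ 0) * nform a (x ^~ 0)).
Proof.
move=> xvg sp zero0.
have zero m t : m != i -> m != j -> m != k -> x m t = 0 /\ v m t = 0.
  move=> mi mj mk; have [x0 v0] := zero0 m mi mj mk.
  exact: (coord_eq0 ai_gt0 aj_gt0 a_bounds xvg sp).
have [dx dv x1 gE] := xvg.
have qE (u w : I -> R -> R) t :
    (forall m, m != i -> m != j -> m != k -> u m t = 0) ->
    qform a (u ^~ t) (w ^~ t) = u i t / ra * (w i t / ra) +
      u j t / rd * (w j t / rd) + u k t * w k t / sg ^+ 2.
  move=> u0; rewrite /qform sum3 => [|m mi mj mk]; last by rewrite u0// !mul0r.
  by rewrite sgE -{1}raE -{1}rdE; field; rewrite ra0 rd0 gt_eqF.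
have nE t : nform a (x ^~ t) = (x i t / ra) ^+ 2 / a i +
    (x j t / rd) ^+ 2 / a j + x k t ^+ 2 / (sg ^+ 2) ^+ 2.
  rewrite /nform sum3 => [|m mi mj mk]; last first.
    by have [-> _] := zero m t mi mj mk; rewrite expr0n mul0r.
  by rewrite sgE !exprMn !exprVn raE rdE; field; rewrite !gt_eqF.
split=> t.
- by split; derive_rules; ring.
- by rewrite aE dE; split; derive_rules; rewrite ?sgE; ring.
- split.
    rewrite -(x1 t) qE; last by move=> m mi mj mk; case: (zero m t).
    by ring.
  rewrite -(flow_tangent xvg t) qE; last by move=> m mi mj mk; case: (zero m t).
  by ring.
- have q2 : (v i t / ra) ^+ 2 + (v j t / rd) ^+ 2 + v k t ^+ 2 / sg ^+ 2 =
      qform a (v ^~ t) (v ^~ t).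
    by rewrite qE => [|m mi mj mk]; [ring|case: (zero m t)].
  rewrite /= aE dE q2 -nE; split; first exact: gE.
  exact: flow_joachimsthal.
Qed.

Lemma small_factor (A B e : R) :
  0 < A -> 0 <= B -> 0 < e -> e <= A / (B + 1) -> e * B < A.
Proof.
move=> A0 B0 e0; rewrite ler_pdivlMr ?ltr_wpDl// mulrDr mulr1 => h.
by apply: lt_le_trans h; rewrite ltrDl.
Qed.

(** Being no umbilic serves twice: [l] does not vanish at [X], and the integral at [X] determines
    the square of the [k]-th velocity. In [planar_growth] the left side is then of order [e^2] and
    the right side of order [e^3]. *)
Lemma focal_plane_false (X : I -> R) (T : R) :
  qform a X X = 1 -> 0 < T -> focal a X T ->
  (forall m, m != i -> m != j -> X m = 0) ->
  a j * (X i / ra) ^+ 2 + a i * (X j / rd) ^+ 2 != a k -> False.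
Proof.
move=> X1 T0 foc Xz nonumb.
set c0 := X i / ra in nonumb *; set s0 := X j / rd in nonumb *.
have Xk : X k = 0 by apply: Xz; rewrite eq_sym.
have cs1 : c0 ^+ 2 + s0 ^+ 2 = 1.
  rewrite -X1 /qform sum3 => [|m mi mj _]; last by rewrite Xz// !mul0r.
  by rewrite Xk /c0 /s0 !exprMn !exprVn raE rdE; ring.
pose l0 := p * c0 - q * s0.
have umb : p ^+ 2 * c0 ^+ 2 - q ^+ 2 * s0 ^+ 2 =
    a j * c0 ^+ 2 + a i * s0 ^+ 2 - a k.
  rewrite -[a k in RHS]mulr1 -cs1 -aE -dE sgE; ring.
have umb0 : p ^+ 2 * c0 ^+ 2 - q ^+ 2 * s0 ^+ 2 != 0 by rewrite umb subr_eq0.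
have l00 : l0 != 0.
  apply: contraNneq umb0 => l00.
  have -> : p ^+ 2 * c0 ^+ 2 - q ^+ 2 * s0 ^+ 2 = l0 * (p * c0 + q * s0).
    by rewrite /l0; ring.
  by rewrite l00 mul0r.
pose Tmin := Num.sqrt (T ^+ 2 * a i / a j).
pose Tmax := Num.sqrt (T ^+ 2 * a j / a i).
have T2 : 0 < T ^+ 2 by exact: exprn_gt0.
have Tmin_gt0 : 0 < Tmin by rewrite sqrtr_gt0 divr_gt0// mulr_gt0.
pose C0 := (1 + Tmax ^+ 2 / (sg ^+ 2 - q ^+ 2)) / sg ^+ 2.
have C0_ge0 : 0 <= C0.
  rewrite /C0 aE sgE divr_ge0 ?(ltW ak_gt0)// addr_ge0//.
  by rewrite divr_ge0 ?sqr_ge0 ?(ltW ai_gt0).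
have [K KE] := @planar_error_bound R p q sg Tmax (1 + 2 * C0) sg_gt0
  (eq_ind_r (fun u => 0 < u) ai_gt0 aE).
pose rate := growth_rate p q sg Tmin.
pose WK := `|2 * wronskian_bound p q sg Tmax * K|.
have rate_gt0 : 0 < rate.
  rewrite /rate /growth_rate dE -/rd.
  have rd_gt0 : 0 < rd by rewrite sqrtr_gt0.
  by rewrite divr_gt0 ?mulr_gt0// addr_gt0.
have l02 : 0 < l0 ^+ 2 by rewrite lt_neqAle eq_sym sqrf_eq0 l00 sqr_ge0.
pose M := expR (energy_rate (a i) (a j) T).
have M0 : 0 < M by exact: expR_gt0.
have M1 : 1 <= M.
  rewrite -[1]expR0 ler_expR /energy_rate addr_ge0//.
  by rewrite !divr_ge0 ?(ltW ai_gt0)// mulr_ge0 ?(ltW aj_gt0) ?(ltW T2).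
(* The four bounds give in turn [e < T], [eta <= 1], the condition [eta_small], and a cubic error
   smaller than the quadratic term. The added 1 keeps denominators positive. *)
pose e := Num.min (Num.min (T / 2) M^-1)
  (Num.min (Tmin ^+ 2 / a j / (M ^+ 2 * C0 + 1))
           (rate * l0 ^+ 2 / (WK * M ^+ 3 + 1))).
have MC : 0 <= M ^+ 2 * C0 by rewrite mulr_ge0 ?sqr_ge0.
have WM : 0 <= WK * M ^+ 3 by rewrite mulr_ge0 ?normr_ge0 ?exprn_ge0 ?(ltW M0).
have A1 : 0 < Tmin ^+ 2 / a j by rewrite divr_gt0 ?exprn_gt0.
have A2 : 0 < rate * l0 ^+ 2 by rewrite mulr_gt0.
have e_gt0 : 0 < e.
  have d1 : 0 < Tmin ^+ 2 / a j / (M ^+ 2 * C0 + 1).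
    by rewrite divr_gt0// ltr_wpDl.
  have d2 : 0 < rate * l0 ^+ 2 / (WK * M ^+ 3 + 1).
    by rewrite divr_gt0// ltr_wpDl.
  by rewrite !lt_min divr_gt0// invr_gt0 M0 d1 d2.
have [[eT eM] [eC eW]] : (e <= T / 2 /\ e <= M^-1) /\
    (e <= Tmin ^+ 2 / a j / (M ^+ 2 * C0 + 1) /\
     e <= rate * l0 ^+ 2 / (WK * M ^+ 3 + 1)).
  by split; split; rewrite /e !ge_min lexx ?orbT.
have hC := small_factor A1 MC e_gt0 eC.
have hW := small_factor A2 WM e_gt0 eW.
have e1 : e <= 1 by rewrite (le_trans eM)// invf_le1.
have eltT : e < T by move: eT T0; lra.
have Te : 0 < T ^+ 2 - e ^+ 2.
  by rewrite subr_gt0 ltr_pXn2r ?nnegrE ?(ltW e_gt0) ?(ltW T0).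
pose r2 := a i * s0 ^+ 2 + a j * c0 ^+ 2.
have r2_gt0 : 0 < r2.
  apply: (@lt_le_trans _ _ (a i)) => //; rewrite -[leLHS]mulr1 -cs1 mulrDr addrC.
  rewrite lerD2l ler_wpM2r ?sqr_ge0//; by case/andP: (a_bounds j).
pose lam := Num.sqrt ((T ^+ 2 - e ^+ 2) / r2).
have lam_gt0 : 0 < lam by rewrite sqrtr_gt0 divr_gt0.
have lamE : lam ^+ 2 * r2 = T ^+ 2 - e ^+ 2.
  by rewrite sqr_sqrtr ?divfK ?gt_eqF// ltW// divr_gt0.
(* In the coordinates [(c, s)] this is [lam] times the positive quarter turn of [(c0, s0)], plus [e]
   along axis [k]; [lam] is chosen so that the length is [T]. *)
pose Y m := if m == i then - (ra * s0 * lam) else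
            if m == j then rd * c0 * lam else
            if m == k then e else 0.
have Yi : Y i = - (ra * s0 * lam) by rewrite /Y eqxx.
have Yj : Y j = rd * c0 * lam by rewrite /Y eq_sym (negbTE ij) eqxx.
have Yk : Y k = e.
  by rewrite /Y eq_sym (negbTE ik) eq_sym (negbTE jk) eqxx.
have Yz m : m != i -> m != j -> m != k -> Y m = 0.
  by rewrite /Y => /negbTE-> /negbTE-> /negbTE->.
have Yt : qform a X Y = 0.
  rewrite /qform sum3 => [|m mi mj _]; last by rewrite Xz// !mul0r.
  rewrite Xk Yi Yj !mul0r addr0 -raE -rdE /c0 /s0.
  by field; rewrite ra0 rd0.
have Yn : \sum_m Y m ^+ 2 = T ^+ 2.
  rewrite sum3 => [|m mi mj mk]; last by rewrite Yz// expr0n.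
  rewrite Yi Yj Yk.
  have -> : (- (ra * s0 * lam)) ^+ 2 + (rd * c0 * lam) ^+ 2 = lam ^+ 2 * r2.
    by rewrite /r2 -raE -rdE; ring.
  by rewrite lamE subrK.
have [x [v [g [xvg x0 v0 x1]]]] := foc Y Yt Yn.
have x0E m : x m 0 = X m by rewrite -x0.
have x1E m : x m 1 = X m by rewrite -x1.
have v0E m : v m 0 = Y m by rewrite -v0.
have sp : \sum_m v m 0 ^+ 2 = T ^+ 2 by rewrite -Yn -v0.
have zero0 m : m != i -> m != j -> m != k -> x m 0 = 0 /\ v m 0 = 0.
  by move=> mi mj mk; rewrite x0E v0E Xz// Yz.
have flow := planar_flow_of_string xvg sp zero0; rewrite x0 v0 in flow.
have Thb : Tmin <= Num.sqrt (qform a Y Y * nform a X * (sg ^+ 2 - q ^+ 2) *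
    (sg ^+ 2 + p ^+ 2)) <= Tmax.
  have /andP[n1 n2] := nform_bounds ai_gt0 aj_gt0 a_bounds X1.
  have /andP[q1 q2] := qform_bounds ai_gt0 aj_gt0 a_bounds Y.
  rewrite Yn in q1 q2; rewrite aE dE.
  have n0 : 0 < nform a X by exact: nform_gt0.
  have q0 : 0 <= qform a Y Y.
    by apply: le_trans q1; rewrite divr_ge0 ?(ltW aj_gt0) ?(ltW T2).
  apply/andP; split; rewrite ler_wsqrtr//.
    have -> : T ^+ 2 * a i / a j = T ^+ 2 / a j * (a j)^-1 * a i * a j.
      by field; rewrite gt_eqF.
    rewrite !ler_pM2r//; apply: ler_pM => //.
      by rewrite divr_ge0 ?(ltW aj_gt0) ?(ltW T2).
    by rewrite invr_ge0 ltW.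
  have -> : T ^+ 2 * a j / a i = T ^+ 2 / a i * (a i)^-1 * a i * a j.
    by field; rewrite gt_eqF.
  by rewrite !ler_pM2r//; apply: ler_pM => //; exact: ltW.
pose eta := e * M.
have eta1 : eta <= 1 by rewrite -ler_pdivlMr// mul1r.
have etaC : eta ^+ 2 * C0 < Tmin ^+ 2 / (sg ^+ 2 + p ^+ 2).
  rewrite dE; apply: le_lt_trans hC; rewrite /eta exprMn -mulrA ler_wpM2r//.
  by rewrite expr2 ler_piMl// ltW.
have y_small t : 0 <= t <= 1 -> `|x k t| <= eta /\ `|v k t| <= eta.
  case/andP=> t0 t1.
  have := coord_energy_le ai_gt0 aj_gt0 a_bounds xvg sp k t0.
  rewrite x0E v0E Xk Yk expr0n add0r => h.
  have {}h : x k t ^+ 2 + v k t ^+ 2 <= eta ^+ 2.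
    apply: (le_trans h); rewrite /eta exprMn ler_wpM2l ?sqr_ge0//.
    apply: (@le_trans _ _ M); last by rewrite expr2 ler_peMl// ltW.
    rewrite ler_expR ler_piMr//.
    rewrite /energy_rate addr_ge0// !divr_ge0 ?(ltW ai_gt0)//.
    by rewrite mulr_ge0 ?(ltW aj_gt0) ?(ltW T2).
  have eta0 : 0 <= eta by rewrite mulr_ge0 ?(ltW e_gt0) ?(ltW M0).
  by split; rewrite -ler_sqr ?nnegrE// real_normK ?num_real//;
    apply: le_trans h; rewrite ?lerDl ?lerDr sqr_ge0.
have or0 : 0 < x i 0 / ra * (v j 0 / rd) - x j 0 / rd * (v i 0 / ra).
  rewrite !x0E !v0E Yi Yj -/c0 -/s0.
  have -> : c0 * (rd * c0 * lam / rd) - s0 * (- (ra * s0 * lam) / ra) = lam.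
    by rewrite -[RHS]mulr1 -cs1; field; rewrite ra0 rd0.
  exact: lam_gt0.
(* As [X k = 0], the integral at [X] is [(1 + rform a k X X)] times the squared [k]-th velocity, and
   this factor is a nonzero multiple of the umbilic expression. *)
have vk1 : v k 1 ^+ 2 = e ^+ 2.
  have := flow_integral_at (bounds_gt0 ai_gt0 a_bounds) xvg a_inj k 1.
  rewrite x1 x0 v0 /integral_at /pform Xk Yk !mulr0 !mul0r !sub0r.
  rewrite !mulrN !opprK => /eqP.
  rewrite -subr_eq0 (_ : _ - _ = (1 + rform a k X X) * (v k 1 ^+ 2 - e ^+ 2)); last by ring.
  rewrite mulf_eq0 => /orP[|]; last by rewrite subr_eq0 => /eqP.
  have -> : 1 + rform a k X X =
      a k * (p ^+ 2 * c0 ^+ 2 - q ^+ 2 * s0 ^+ 2) / (p ^+ 2 * q ^+ 2).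
    have rE : rform a k X X = X i ^+ 2 / (a k - a i) + X j ^+ 2 / (a k - a j).
      rewrite /rform big_mkcond sum3 => [|m mi mj _].
        by rewrite ik jk eqxx addr0 !expr2.
      by rewrite Xz// !mul0r; case: ifP.
    have X2i : X i ^+ 2 = a i * c0 ^+ 2.
      by rewrite /c0 exprMn exprVn raE mulrCA divff ?mulr1// gt_eqF.
    have X2j : X j ^+ 2 = a j * s0 ^+ 2.
      by rewrite /s0 exprMn exprVn rdE mulrCA divff ?mulr1// gt_eqF.
    rewrite rE X2i X2j.
    have -> : a k - a i = q ^+ 2 by rewrite -aE -sgE; ring.
    have -> : a k - a j = - p ^+ 2 by rewrite -dE -sgE; ring.
    by rewrite -[X in X + _]cs1 -aE -dE -sgE; field; rewrite !gt_eqF.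
  have pq0 : 0 < p ^+ 2 * q ^+ 2 by rewrite mulr_gt0 ?exprn_gt0.
  rewrite mulf_eq0 invr_eq0 [p ^+ 2 * _ == 0]gt_eqF// orbF.
  by rewrite mulf_eq0 (negbTE umb0) gt_eqF.
have wE : ((p * (x i 1 / ra) - q * (x j 1 / rd)) * v k 1) ^+ 2 =
    ((p * (x i 0 / ra) - q * (x j 0 / rd)) * v k 0) ^+ 2.
  by rewrite !x0E !x1E v0E Yk !exprMn vk1.
have := planar_growth p_gt0 q_gt0 sg_gt0 (eq_ind_r (fun u => 0 < u) ai_gt0 aE)
  flow Tmin_gt0 Thb (erefl C0) etaC eta1 y_small or0 KE
  (etrans (x0E k) Xk) (etrans (x1E k) Xk) wE.
rewrite !x0E v0E Yk -/c0 -/s0 -/l0 -/rate [(l0 * e) ^+ 2]exprMn.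
apply/negP; rewrite -ltNge.
apply: (@le_lt_trans _ _ (WK * eta ^+ 3)).
  by rewrite ler_wpM2r ?ler_norm// exprn_ge0// mulr_ge0 ?(ltW e_gt0) ?(ltW M0).
rewrite /eta exprMn (_ : WK * (e ^+ 3 * M ^+ 3) = e * (WK * M ^+ 3) * e ^+ 2); last by ring.
by rewrite [rate * _]mulrA ltr_pM2r// exprn_gt0.
Qed.

End FocalPlane.

(** * Diagonal ellipsoids *)

Section DiagonalEllipsoid.
Context {R : realType} {n : nat}.
Variable A : 'M[R]_n.
Hypothesis A_diag : is_diag_mx A.
Hypothesis A_pos : positive_definite A.

Let a (i : 'I_n) : R := A i i.

Lemma diag_entry_gt0 i : 0 < a i.
Proof.
have d0 : delta_mx i 0 != 0 :> 'cV[R]_n.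
  by apply/eqP => /matrixP /(_ i 0); rewrite !mxE !eqxx => /eqP; rewrite oner_eq0.
have := A_pos.2 _ d0; rewrite /dot (bigD1 i)//= big1 => [|j ji].
  by rewrite -colE !mxE !eqxx mulr1 addr0.
by rewrite [delta_mx _ _ _ _]mxE (negbTE ji) mulr0.
Qed.

(** Two equal diagonal entries would be a root of the characteristic polynomial of multiplicity at
    least 2. *)
Lemma diag_entry_inj : simple_eigenvalues A -> injective a.
Proof.
move=> simple i j aij; apply/eqP/negPn/negP => ij.
have cp := char_poly_trig (is_diag_mx_is_trig A_diag).
have ev : eigenvalue A (a i).
  rewrite eigenvalue_root_char cp /root horner_prod (bigD1 i)//= hornerXsubC.
  by rewrite subrr mul0r.
have := simple _ ev.
have -> : char_poly A = \prod_(y <- [seq a m | m <- enum 'I_n]) ('X - y%:P).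
  by rewrite cp big_map big_enum.
rewrite mu_prod_XsubC count_map => c1.
have : (2 <= count (preim a (pred1 (a i))) (enum 'I_n))%N; last by rewrite c1.
rewrite -size_filter -(@card_uniqP _ [seq x <- enum 'I_n | _] _); last first.
  by rewrite filter_uniq// enum_uniq.
apply/card_gt1P; exists i, j; split=> //.
  by rewrite mem_filter mem_enum /= eqxx.
by rewrite mem_filter mem_enum /= -aij eqxx.
Qed.

Lemma conormal_coord (x : 'cV[R]_n) i : conormal A x i 0 = x i 0 / a i.
Proof.
have Au : A \in unitmx.
  rewrite unitmxE det_trig ?is_diag_mx_is_trig// unitfE prodf_seq_neq0.
  by apply/allP => j _ /=; rewrite gt_eqF// diag_entry_gt0.
pose y : 'cV[R]_n := \col_j (x j 0 / a j).
have -> : conormal A x = y; last by rewrite mxE.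
rewrite /conormal; have <- : A *m y = x; last by rewrite mulKmx.
apply/colP => j; rewrite mxE (bigD1 j)//= big1 => [|k kj].
  by rewrite mxE addr0 mulrC divfK// gt_eqF// diag_entry_gt0.
by move/is_diag_mxP: A_diag => -> //; rewrite ?mul0r// eq_sym.
Qed.

Lemma dot_conormal x y :
  dot (conormal A x) y = qform a (fun i => x i 0) (fun i => y i 0).
Proof. by apply: eq_bigr => i _; rewrite conormal_coord; ring. Qed.

Lemma is_derive_coord (c : R -> 'cV[R]_n) (t : R) i : derivable c t 1 ->
  is_derive t 1 (fun s => c s i 0) (derive1 c t i 0).
Proof.
move=> dc; have dci := (derivable_mxP c t 1).1 dc i 0.
by rewrite derive1E derive_mx// mxE; exact/derivableP.
Qed.

Lemma geodesic_flow_coord (c : R -> 'cV[R]_n) : geodesic A c ->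
  exists g, string_flow a (fun i t => c t i 0) (fun i t => derive1 c t i 0) g.
Proof.
move=> geo.
pose x := fun i t => c t i 0; pose v := fun i t => derive1 c t i 0.
pose w := fun i t => derive1 (derive1 c) t i 0.
have dx i (t : R) : is_derive t 1 (x i) (v i t).
  by apply: is_derive_coord; case: (geo t).
have dv i (t : R) : is_derive t 1 (v i) (w i t).
  by apply: is_derive_coord; case: (geo t).
have x1 t : qform a (x ^~ t) (x ^~ t) = 1.
  by rewrite -dot_conormal; case: (geo t).
have wn t u : qform a (x ^~ t) u = 0 -> \sum_i w i t * u i = 0.
  move=> xu; have [_ _ _ /(_ (\col_i u i))] := geo t.
  rewrite /tangent /= dot_conormal /dot.
  have -> : (fun i => (\col_i u i : 'cV[R]_n) i 0) = u.
    by apply/funext => i; rewrite mxE.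
  move=> /(_ xu) h; apply: etrans h.
  by apply: eq_bigr => i _; rewrite [in RHS]mxE.
by exists (fun t => qform a (v ^~ t) (v ^~ t) / nform a (x ^~ t));
  exact: (normal_acceleration_flow diag_entry_gt0 dx dv x1 wn).
Qed.

Lemma self_focal_focal (x0 : 'cV[R]_n) : ellipsoid A x0 -> self_focal A x0 ->
  exists2 T, 0 < T & focal a (fun i => x0 i 0) T.
Proof.
move=> x0_ell [T T0 foc]; exists T => // Y Yt Yn.
pose xi : 'cV[R]_n := \col_i (T^-1 * Y i).
have T0' : T != 0 by rewrite gt_eqF.
have xi_cos : cosphere_at A x0 (x0, xi).
  split=> //; split=> //; split=> /=.
    rewrite /tangent /= dot_conormal -[RHS](mulr0 T^-1) -Yt /qform mulr_sumr.
    by apply: eq_bigr => i _; rewrite mxE; ring.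
  transitivity (T ^- 2 * \sum_i Y i ^+ 2); last by rewrite Yn mulVf// sqrf_eq0.
  by rewrite mulr_sumr; apply: eq_bigr => i _; rewrite !mxE; field.
have [c [geo c0 dc0 c1]] := foc _ xi_cos.
have [g cvg] := geodesic_flow_coord geo.
exists (fun i t => c t i 0), (fun i t => derive1 c t i 0), g; split=> //.
- by rewrite c0.
- by apply/funext => i; rewrite dc0 !mxE mulVKf.
- by rewrite c1.
Qed.

(** At least two axes [k] are not extreme. The left side of the umbilic condition does not involve
    [k], so it cannot equal [a k] for both. *)
Lemma not_self_focal (x0 : 'cV[R]_n) : (4 <= n)%N -> simple_eigenvalues A ->
  ellipsoid A x0 -> ~ self_focal A x0.
Proof.
move=> n4 A_simple x0_ell x0_focal.
have a_inj := diag_entry_inj A_simple.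
have [T T0 foc] := self_focal_focal x0_ell x0_focal.
set X := fun i : 'I_n => x0 i 0 in foc.
have X1 : qform a X X = 1 by rewrite -dot_conormal.
have i0 : 'I_n := Ordinal (leq_trans (isT : (0 < 4)%N) n4).
have [i imin] : exists i, forall m, a i <= a m.
  by case: (@arg_minP _ _ _ i0 xpredT a) => // i _ h; exists i => m; exact: h.
have [j jmax] : exists j, forall m, a m <= a j.
  by case: (@arg_maxP _ _ _ i0 xpredT a) => // j _ h; exists j => m; exact: h.
have a_bounds m : a i <= a m <= a j by rewrite imin// jmax.
have middle k : k != i -> k != j -> a i < a k < a j.
  move=> ki kj; have /andP[h1 h2] := a_bounds k.
  by rewrite !lt_neqAle h1 h2 !(inj_eq a_inj) eq_sym ki kj.
have Xz k : k != i -> k != j -> X k = 0.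
  move=> ki kj; apply: (focal_middle_coord _ _ a_bounds a_inj X1 T0 foc
    (middle k ki kj)); exact: diag_entry_gt0.
have /card_gt1P[k1 [k2 [k1ij k2ij k12]]] : (1 < #|(~: [set i; j])%SET|)%N.
  have := cardsC [set i; j]%SET; rewrite card_ord => cE.
  have : (#|[set i; j]%SET| <= 2)%N by rewrite cards2; case: (i != j).
  lia.
have umbilic k : k \in (~: [set i; j])%SET ->
    a j * (X i / Num.sqrt (a i)) ^+ 2 + a i * (X j / Num.sqrt (a j)) ^+ 2 = a k.
  rewrite !inE negb_or => /andP[ki kj]; apply/eqP/negPn/negP => nonumb.
  exact: (focal_plane_false (diag_entry_gt0 i) a_bounds a_inj (middle k ki kj)
    X1 T0 foc Xz nonumb).
by move/eqP: k12; apply; apply: a_inj; rewrite -(umbilic _ k1ij) -(umbilic _ k2ij).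
Qed.

End DiagonalEllipsoid.

Theorem proposition0p7 (R : realType) (n : nat) (n_ge4 : (4 <= n)%N)
    (A : 'M[R]_n) (A_diag : is_diag_mx A) (A_pos : positive_definite A)
    (A_simple : simple_eigenvalues A)
    (x0 : 'cV[R]_n) (x0_ell : ellipsoid A x0) (x0_focal : self_focal A x0) :
  [/\ exists a : 'rV[R]_(n - 2),
        cosphere_at A x0 `<=` cosphere A `&` moment_map A @^-1` [set a],
      forall H : set 'cV[R]_n, hypersurface A H -> H x0 ->
        nondegenerate_second_fundamental_form A H ->
        reduced_leaf A H (cosphere_at A x0) &
      exists2 O : set ('cV[R]_n * 'cV[R]_n),
        regular_orbit A O & flow_out A x0 = closure O].
Proof.
by have := not_self_focal A_diag A_pos n_ge4 A_simple x0_ell x0_focal.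
Qed.
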